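(* Let $d \in \mathbb{N}$ and $\alpha \in (0,\infty)$. Let $\boldsymbol{c} : \mathbb{N} \to \mathbb{N} \cup \{\infty\}$ be non-decreasing and of the form $\boldsymbol{c}(n) \asymp n^{\theta} \cdot (\log(2n))^{\kappa}$ for certain $\theta \geq 0$ and $\kappa \in \mathbb{R}$, and let $\boldsymbol{\ell} : \mathbb{N} \to \mathbb{N}_{\geq 5} \cup \{\infty\}$ be non-decreasing with $\boldsymbol{\ell}^\ast := \sup_{n \in \mathbb{N}} \boldsymbol{\ell}(n) < \infty$. Then $$ \frac{1}{d} \cdot \frac{\alpha}{\alpha + (2^{\boldsymbol{\ell}^\ast} - 1)(\theta + 1/2)} \;\leq\; err\bigl(U^{\alpha,\infty}_{\boldsymbol{\ell},\boldsymbol{c},\varrho_2}([0,1]^d), \iota_\infty\bigr) \;\leq\; \frac{64}{d} \cdot \frac{\alpha}{8\alpha + (2^{\boldsymbol{\ell}^\ast} - 1)(\theta + 1/2)} . $$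
   Context: $\mathbb{N} = \{1,2,3,\dots\}$. The relation $a(n) \asymp b(n)$ means that each side is bounded by a positive constant (independent of $n$) times the other. Neural networks. A neural network with $L$ layers is a sequence $\Phi = ((A_1,b_1),\dots,(A_L,b_L))$ with $A_j \in \mathbb{R}^{N_j \times N_{j-1}}$, $b_j \in \mathbb{R}^{N_j}$, $N_0,\dots,N_L \in \mathbb{N}$. Put $L(\Phi) = L$, $d_{\mathrm{in}}(\Phi) = N_0$, $d_{\mathrm{out}}(\Phi) = N_L$, $W(\Phi) = \sum_{j=1}^L (\|A_j\|_{\ell^0} + \|b_j\|_{\ell^0})$ where $\|\cdot\|_{\ell^0}$ counts nonzero entries, and $\|\Phi\|_{\mathcal{NN}} = \max_j \max\{\|A_j\|_\infty, \|b_j\|_\infty\}$ where $\|\cdot\|_\infty$ is the largest absolute value of an entry. The activation function is the ReQU $\varrho_2(x) = \max(0,x)^2$, applied componentwise to vectors, and the realization is $R_{\varrho_2}\Phi = T_L \circ (\varrho_2 \circ T_{L-1}) \circ \cdots \circ (\varrho_2 \circ T_1) : \mathbb{R}^{N_0} \to \mathbb{R}^{N_L}$ with $T_j x = A_j x + b_j$. For non-decreasing $\boldsymbol{\ell}, \boldsymbol{c}$ and $n \in \mathbb{N}$, let $\Sigma_n^{\boldsymbol{\ell},\boldsymbol{c},\varrho_2}$ be the set of all $R_{\varrho_2}\Phi$ where $d_{\mathrm{in}}(\Phi) = d$, $d_{\mathrm{out}}(\Phi) = 1$, $W(\Phi) \leq n$, $L(\Phi) \leq \boldsymbol{\ell}(n)$,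 $\|\Phi\|_{\mathcal{NN}} \leq \boldsymbol{c}(n)$. Approximation space. For measurable $u : [0,1]^d \to \mathbb{R}$ let $$\Gamma(u) := \max\Bigl\{ \|u\|_{L^\infty([0,1]^d)},\ \sup_{n \in \mathbb{N}} \bigl[ n^\alpha \cdot \inf_{g \in \Sigma_n^{\boldsymbol{\ell},\boldsymbol{c},\varrho_2}} \|u - g\|_{L^\infty([0,1]^d)} \bigr] \Bigr\} \in [0,\infty],$$ $\|u\|_{A^{\alpha,\infty}_{\boldsymbol{\ell},\boldsymbol{c},\varrho_2}} := \inf\{t > 0 : \Gamma(u/t) \leq 1\}$, and let $A^{\alpha,\infty}_{\boldsymbol{\ell},\boldsymbol{c},\varrho_2}([0,1]^d)$ be the set of $u \in L^\infty([0,1]^d)$ for which this is finite. Its elements are (identified with) continuous functions on $[0,1]^d$. $U^{\alpha,\infty}_{\boldsymbol{\ell},\boldsymbol{c},\varrho_2}([0,1]^d)$ denotes the set of $u$ in this space with $\|u\|_{A^{\alpha,\infty}_{\boldsymbol{\ell},\boldsymbol{c},\varrho_2}} \leq 1$, regarded as a subset of $C([0,1]^d)$. $\iota_\infty$ denotes the embedding $u \mapsto u$ into $C([0,1]^d)$, with error measured in the uniform norm $\|\cdot\|_{L^\infty([0,1]^d)}$. Optimal order. For a bounded nonempty $U \subset C([0,1]^d)$ and a Banach space $Y$, $\mathrm{Alg}_m(U,Y)$ is the set of maps $A : U \to Y$ for which there exist points $x_1,\dots,x_m \in [0,1]^d$ and a map $Q : \mathbb{R}^m \to Y$ with $A(u)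 = Q(u(x_1),\dots,u(x_m))$ for all $u \in U$. For $S : U \to Y$, $$err(U,S) := \sup\Bigl\{\beta \geq 0 : \exists C > 0\ \forall m \in \mathbb{N}:\ \inf_{A \in \mathrm{Alg}_m(U,Y)} \sup_{u \in U} \|A(u) - S(u)\|_Y \leq C \cdot m^{-\beta}\Bigr\}.$$ *)

(* Defs.v *)
From HB Require Import structures.
From mathcomp Require Import all_boot all_order all_algebra.
From mathcomp Require Import all_classical all_reals all_analysis.

Set Implicit Arguments.
Unset Strict Implicit.
Unset Printing Implicit Defensive.

Import Order.TTheory GRing.Theory Num.Theory.
Import numFieldNormedType.Exports.

Local Open Scope classical_set_scope.
Local Open Scope ring_scope.

(* Lebesgue measure on R^n, with points of R^n as n-tuples because that is the
   type on which the library has the product sigma-algebra: it is built by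
   adding one factor at a time, mu_{n+1} being the image of lambda (x) mu_n
   under (x, t) |-> x :: t, and mu_0 the unit mass on the one-point space. *)
Section LebesgueTuple.
Variable R : realType.

Definition tuple_cons n (p : measurableTypeR R * n.-tuple (measurableTypeR R)) :
  n.+1.-tuple (measurableTypeR R) := [tuple of p.1 :: p.2].

Lemma measurable_tuple_cons n : measurable_fun setT (@tuple_cons n).
Proof. exact: measurable_cons. Qed.

Section Step.
Variables (n : nat)
  (mu : {sigma_finite_measure set (n.-tuple (measurableTypeR R)) -> \bar R}).

Definition lebesgue_tuple_step : set (n.+1.-tuple (measurableTypeR R)) -> \bar R :=
  pushforward (@lebesgue_measure R \x mu)%E (@tuple_cons n).

Let mtc := @measurable_tuple_cons n.

Let step0 : (lebesgue_tuple_step set0 = 0)%E.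
Proof. by rewrite /lebesgue_tuple_step /pushforward preimage_set0 measure0. Qed.

Let step_ge0 A : (0 <= lebesgue_tuple_step A)%E.
Proof. exact: measure_ge0. Qed.

Let step_sigma_additive : semi_sigma_additive lebesgue_tuple_step.
Proof.
move=> F mF tF mUF; rewrite /lebesgue_tuple_step /pushforward preimage_bigcup.
apply: measure_semi_sigma_additive.
- by move=> i; rewrite -[X in measurable X]setTI; exact: mtc.
- apply/trivIsetP => /= i j _ _ ij; rewrite -preimage_setI.
  by move/trivIsetP : tF => /(_ i j Logic.I Logic.I ij) ->; rewrite preimage_set0.
- by rewrite -preimage_bigcup -[X in measurable X]setTI; exact: mtc.
Qed.

HB.instance Definition _ := isMeasure.Build _ _ _ lebesgue_tuple_step
  step0 step_ge0 step_sigma_additive.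

Let step_sigma_finite : sigma_finite setT lebesgue_tuple_step.
Proof.
pose s (t : n.+1.-tuple (measurableTypeR R)) := (thead t, [tuple of behead t]).
have ms : measurable_fun setT s.
  apply: measurable_fun_pair; first exact: measurable_tnth.
  exact: measurable_behead.
have sK p : s (tuple_cons p) = p.
  case: p => x t; rewrite /s /tuple_cons /= theadE; congr pair.
  by apply/val_inj.
have /sigma_finiteP[F [TF ndF Foo]] := sigma_finiteT (@lebesgue_measure R).
have /sigma_finiteP[G [TG ndG Goo]] := sigma_finiteT mu.
exists (fun k => s @^-1` (F k `*` G k)).
  rewrite -preimage_bigcup -[LHS](preimage_setT s); congr preimage.
  rewrite -setXTT TF TG predeqE => -[x y]; split; last first.
    by move=> [k _ []/= ? ?]; split; exists k.
  move=> [/= [k _ Fkx] [l _ Gly]]; exists (maxn k l) => //; split.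
  - by move: x Fkx; exact/subsetPset/ndF/leq_maxl.
  - by move: y Gly; exact/subsetPset/ndG/leq_maxr.
move=> k; have [mF Fk] := Foo k; have [mG Gk] := Goo k; split.
  rewrite -[X in measurable X]setTI; apply: ms => //; exact: measurableX.
rewrite /lebesgue_tuple_step /pushforward.
rewrite (_ : _ @^-1` _ = F k `*` G k); last first.
  by apply/seteqP; split => p; rewrite /preimage /mkset sK.
by rewrite product_measure1E// lte_mul_pinfty// ge0_fin_numE.
Qed.

HB.instance Definition _ := Measure_isSigmaFinite.Build _ _ _
  lebesgue_tuple_step step_sigma_finite.

End Step.

Fixpoint lebesgue_tuple (n : nat) :
    {sigma_finite_measure set (n.-tuple (measurableTypeR R)) -> \bar R} :=
  match n with
  | 0 => \d_([tuple])
  | n'.+1 => lebesgue_tuple_step (lebesgue_tuple n')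
  end.

End LebesgueTuple.

(* The Banach space C([0,1]^d) with the uniform norm. *)
Section ContinuousCube.
Variables (R : realType) (d : nat).

Definition unit_cube : set 'cV[R]_d := [set x | forall i, 0 <= x i 0 <= 1].

Let unit_cube0 : unit_cube 0.
Proof. by move=> i; rewrite mxE lexx ler01. Qed.

Let cube0 : unit_cube := exist _ 0 (mem_set unit_cube0).

Lemma compact_unit_cube : compact unit_cube.
Proof.
pose B := [set v : 'rV[R]_d | forall i, `[0, 1]%classic (v ord0 i)].
have cB : compact B by apply: (@rV_compact R d (fun=> `[0, 1]%classic)) => _; exact: segment_compact.
have -> : unit_cube = trmx @` B.
  apply/seteqP; split => [x x01|_ [v v01 <-] i].
    exists x^T; last by rewrite trmxK.
    by move=> i /=; rewrite mxE in_itv /=; exact: x01.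
  by rewrite mxE; have := v01 i; rewrite /= in_itv.
apply: continuous_compact => //; apply: continuous_subspaceT => v.
move=> A [P vP PA]; exists (fun i j => P j i) => [i j|w Pw].
  by have := vP j i; rewrite mxE.
by apply: PA => i j; rewrite mxE; exact: Pw.
Qed.

Lemma compact_cube : compact [set: unit_cube].
Proof.
move=> F FF _.
have FU : F (set_val @^-1` unit_cube).
  by apply: (@filterS _ F _ setT) => [x _|]; [exact: set_valP|exact: filterT].
have [p [Up clp]] := compact_unit_cube (fmap_proper_filter set_val FF) FU.
exists (exist _ p (mem_set Up)); split=> // A B FA [_ /= [[V oV <-] /= Vp VB]].
have FA' : F (set_val @^-1` (set_val @` A)) by apply: filterS FA => x Ax; exists x.
have [_ [[x Ax <-] Vx]] := clp _ _ FA' (open_nbhs_nbhs (conj oV Vp)).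
by exists x; split => //; exact: VB.
Qed.

Definition continuous_cube : {pred (unit_cube -> R)} :=
  mem [set f : unit_cube -> R | continuous f].

Record Ccube := MkCcube {
  Ccube_fun :> unit_cube -> R ;
  _ : Ccube_fun \in continuous_cube }.

HB.instance Definition _ := [isSub for Ccube_fun].
HB.instance Definition _ := [Choice of Ccube by <:].

Lemma Ccube_continuous (f : Ccube) : continuous f.
Proof. by case: f => f /=; rewrite inE. Qed.

Lemma continuous_cube_submod : submod_closed continuous_cube.
Proof.
split=> [|a f g]; first by rewrite inE; exact: (@cst_continuous _ R 0).
rewrite !inE => cf cg x.
exact: (cvgD (cvgM (cvg_cst a) (cf x)) (cg x)).
Qed.

HB.instance Definition _ := GRing.isSubmodClosed.Build _ _ continuous_cube
  continuous_cube_submod.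
HB.instance Definition _ := [SubChoice_isSubLmodule of Ccube by <:].

Definition unif_norm (f : Ccube) : R := sup [set `|f x| | x in [set: unit_cube]].

Lemma Ccube_has_sup (f : Ccube) : has_sup [set `|f x| | x in [set: unit_cube]].
Proof.
split.
  by exists `|f cube0|; exists cube0.
have : compact (f @` [set: unit_cube]).
  apply: continuous_compact; last exact: compact_cube.
  by apply: continuous_subspaceT; exact: Ccube_continuous.
move=> /compact_bounded[M [Mreal MP]]; exists (M + 1) => _ [x _ <-].
by apply: (MP (M + 1)); [rewrite ltrDl|exists x].
Qed.

Lemma unif_norm_ge (f : Ccube) x : `|f x| <= unif_norm f.
Proof. by apply: ub_le_sup; [case: (Ccube_has_sup f)|exists x]. Qed.

Lemma unif_norm_le (f : Ccube) M : (forall x, `|f x| <= M) -> unif_norm f <= M.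
Proof.
move=> fM; apply: ge_sup; first by case: (Ccube_has_sup f).
by move=> _ [x _ <-].
Qed.

Lemma unif_normD f g : unif_norm (f + g) <= unif_norm f + unif_norm g.
Proof.
apply: unif_norm_le => x; apply: (le_trans (ler_normD _ _)).
by apply: lerD; exact: unif_norm_ge.
Qed.

Lemma unif_normZ l f : unif_norm (l *: f) = `|l| * unif_norm f.
Proof.
have le_normZ k g : unif_norm (k *: g) <= `|k| * unif_norm g.
  apply: unif_norm_le => x; rewrite [X in `|X|](_ : _ = k * g x)// normrM.
  by apply: ler_wpM2l => //; exact: unif_norm_ge.
apply/eqP; rewrite eq_le le_normZ /=.
have [->|l0] := eqVneq l 0.
  by rewrite normr0 mul0r; exact: le_trans (normr_ge0 _) (unif_norm_ge _ cube0).
rewrite -{1}(scalerK l0 f) mulrC -ler_pdivlMr ?normr_gt0//.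
by rewrite mulrC -normfV; exact: le_normZ.
Qed.

Lemma unif_norm0_eq0 f : unif_norm f = 0 -> f = 0.
Proof.
move=> f0; apply/val_inj/funext => x; apply/eqP.
by rewrite -normr_le0 -f0; exact: unif_norm_ge.
Qed.

HB.instance Definition _ := Lmodule_isNormed.Build R Ccube
  unif_normD unif_normZ unif_norm0_eq0.

Lemma Ccube_complete (F : set_system Ccube) : ProperFilter F -> cauchy F -> cvg F.
Proof.
move=> FF Fc.
pose G : set_system (arrow_uniform_type unit_cube R) := Ccube_fun @ F.
have FG : ProperFilter G by exact: fmap_proper_filter.
have Gc : cauchy G.
  apply/cauchy_exP => e e0.
  have [f Ff] := (iffLR (cauchyP (R := R) F)) Fc e e0.
  exists (f : unit_cube -> R); apply: (@filterS _ F FF (ball f e)) => // g fg t.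
  rewrite -ball_normE /=; apply: le_lt_trans (unif_norm_ge (f - g) t) _.
  by move: fg; rewrite -ball_normE.
have [h /cvg_fct_entourageP Gh] :
    exists h : arrow_uniform_type unit_cube R, G --> h.
  by exists (lim G); exact: fun_complete Gc.
have ch : continuous (h : unit_cube -> R).
  apply: (@uniform_limit_continuous _ _ G h FG).
    by apply: (@filterS _ F FF setT) => [f _|]; [exact: Ccube_continuous|exact: filterT].
  move=> P /uniform_nbhs[E [entE EP]].
  apply: (@filterS _ G FG [set g | forall t, E (h t, g t)]) => [g hg|].
    by apply: EP => t _; exact: hg.
  exact: Gh.
apply/cvg_ex; exists (MkCcube (mem_set ch)).
apply/cvg_ballP => e e0.
have e20 : 0 < e / 2 by rewrite divr_gt0.
have := Gh _ (entourage_ball (R : pseudoMetricType R) (PosNum e20)).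
apply: (@filterS _ F FF [set f : Ccube | forall t, ball (h t) (e / 2) (f t)]) => g hg.
rewrite -ball_normE /=.
apply: le_lt_trans (_ : e / 2 < e); last by rewrite ltr_pdivrMr// ltr_pMr// ltr1n.
apply: unif_norm_le => t; apply: ltW.
by have := hg t.
Qed.

HB.instance Definition _ := Uniform_isComplete.Build Ccube Ccube_complete.

End ContinuousCube.
Arguments unit_cube : clear implicits.

(* ||u||_{L^oo([0,1]^d)} for u : [0,1]^d -> R: the essential supremum, with
   respect to Lebesgue measure on R^d, of |u| extended by 0 off the cube. *)
Section Linfty.
Variables (R : realType) (d : nat).

Definition zero_ext (u : unit_cube R d -> R) (x : 'cV[R]_d) : R :=
  oapp u 0 (insub x).

Definition Linfty_norm (u : unit_cube R d -> R) : \bar R :=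
  Lnorm (@lebesgue_tuple R d) +oo%E (fun t => (zero_ext u (\col_i tnth t i))%:E).

End Linfty.

(* [network R dout din]: the sequences ((A_1,b_1),...,(A_L,b_L)) with L >= 1,
   N_0 = din, N_L = dout and hidden dimensions N_1,...,N_{L-1} >= 1, the first
   layer (A_1,b_1) being outermost. *)
Inductive network (R : Type) (dout : nat) : nat -> Type :=
| OutputLayer din of 'M[R]_(dout, din) & 'cV[R]_dout : network R dout din
| HiddenLayer din k of (0 < k)%N & 'M[R]_(k, din) & 'cV[R]_k & network R dout k :
    network R dout din.

Section Network.
Variable R : realType.

Definition requ (x : R) : R := Num.max 0 x ^+ 2.

Definition nnz m n (A : 'M[R]_(m, n)) : nat :=
  #|[set ij : 'I_m * 'I_n | A ij.1 ij.2 != 0]|.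

Fixpoint nn_depth dout din (Phi : network R dout din) : nat :=
  match Phi with
  | OutputLayer _ _ _ => 1
  | HiddenLayer _ _ _ _ _ Psi => (nn_depth Psi).+1
  end.

Fixpoint nn_weights dout din (Phi : network R dout din) : nat :=
  match Phi with
  | OutputLayer _ A b => (nnz A + nnz b)%N
  | HiddenLayer _ _ _ A b Psi => (nnz A + nnz b + nn_weights Psi)%N
  end.

(* The library norm on matrices is the largest absolute value of an entry. *)
Fixpoint nn_norm dout din (Phi : network R dout din) : R :=
  match Phi with
  | OutputLayer _ A b => Num.max `|A| `|b|
  | HiddenLayer _ _ _ A b Psi => Num.max (Num.max `|A| `|b|) (nn_norm Psi)
  end.

Fixpoint realization dout din (Phi : network R dout din) :
    'cV[R]_din -> 'cV[R]_dout :=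
  match Phi with
  | OutputLayer _ A b => fun x => A *m x + b
  | HiddenLayer _ _ _ A b Psi =>
      fun x => realization Psi (map_mx requ (A *m x + b))
  end.

End Network.

(* Sequences indexed by {1,2,...} are functions on nat whose value at 0 is
   never used. *)
Section ApproximationSpace.
Variables (R : realType) (d : nat).
Implicit Types (alpha : R) (l c : nat -> \bar R) (u : unit_cube R d -> R).

Definition Sigma l c (n : nat) : set ('cV[R]_d -> R) :=
  [set g | exists Phi : network R 1 d,
    [/\ (nn_weights Phi <= n)%N,
        ((nn_depth Phi)%:R%:E <= l n)%E,
        ((nn_norm Phi)%:E <= c n)%E
      & g = fun x => realization Phi x 0 0]].

Definition best_error l c n u : \bar R :=
  ereal_inf [set Linfty_norm (fun x => u x - g (val x)) | g in Sigma l c n].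

Definition approx_gauge alpha l c u : \bar R :=
  maxe (Linfty_norm u)
    (ereal_sup [set ((n%:R `^ alpha)%:E * best_error l c n u)%E
               | n in [set n | (0 < n)%N]]).

Definition approx_norm alpha l c u : \bar R :=
  ereal_inf [set t%:E | t in
    [set t : R | 0 < t /\ (approx_gauge alpha l c (fun x => (u x / t)%R) <= 1)%E]].

Definition approx_unit_ball alpha l c : set (Ccube R d) :=
  [set u | (approx_norm alpha l c u <= 1)%E].

End ApproximationSpace.

(* A map A : U -> Y is represented by a map on all of C([0,1]^d) whose values
   off U are never used. *)
Section OptimalOrder.
Variables (R : realType) (d : nat) (Y : completeNormedModType R).
Implicit Types (U : set (Ccube R d)) (S : Ccube R d -> Y).

Definition Alg (m : nat) U : set (Ccube R d -> Y) :=
  [set A | exists (x : 'I_m -> unit_cube R d) (Q : 'rV[R]_m -> Y),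
    forall u, U u -> A u = Q (\row_i u (x i))].

Definition alg_error U S (A : Ccube R d -> Y) : \bar R :=
  ereal_sup [set `|A u - S u|%:E | u in U].

Definition err U S : \bar R :=
  ereal_sup [set beta%:E | beta in [set beta : R | 0 <= beta /\
    exists2 C : R, 0 < C & forall m : nat, (0 < m)%N ->
      (ereal_inf [set alg_error U S A | A in Alg m U]
        <= (C * m%:R `^ (- beta))%:E)%E]].

End OptimalOrder.

Section Growth.
Variable R : realType.

(* N_{>= k} with +oo added. *)
Definition nat_ge_or_infty (k : nat) : set (\bar R) :=
  [set x | x = +oo%E \/ exists2 j : nat, (k <= j)%N & x = j%:R%:E].

Definition nondecreasing_pos (a : nat -> \bar R) : Prop :=
  forall m n : nat, (0 < m)%N -> (m <= n)%N -> (a m <= a n)%E.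

Definition asymp (a b : nat -> \bar R) : Prop :=
  exists C1 C2 : R, [/\ 0 < C1, 0 < C2 &
    forall n : nat, (0 < n)%N ->
      (a n <= C1%:E * b n)%E /\ (b n <= C2%:E * a n)%E].

Definition sup_pos (a : nat -> \bar R) : \bar R :=
  ereal_sup [set a n | n in [set n | (0 < n)%N]].

End Growth.
Arguments nat_ge_or_infty : clear implicits.

(* Main.v *)
(* Let P = 2^L - 1 with L the largest admissible depth, and s = theta + 1/2.

   Lower bound.  With M = n c(n)^2, every affine layer of a network in Sigma_n is
   M^(1/2)-Lipschitz up to constants, and squaring the activations doubles the
   exponent at each layer; so the network is M^(P/2)-Lipschitz on the cube, that is,
   n^(P s) up to logarithms.  Two functions of the unit ball that agree on a grid of
   mesh m^(-1/d) therefore differ by at most n^-alpha + n^(P s) m^(-1/d), up to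
   constants; choose n = m^(beta / alpha).  The algorithm returns any element of the
   unit ball that interpolates the data.

   Upper bound.  Layers of neurons K (1 + sigma z_i) with sigma in {-1, 0, 1}, each
   copied N times, reproduce themselves with gain K' = N c K^2, because
   (1 + z)^2 - (1 - z)^2 = 4 z.  The function requ(a - N K^2 |z|^2) with
   a = n^(-alpha/2) is thus realized with n ~ N^2 weights, has height n^-alpha and
   vanishes as soon as some |z_i| >= n^(-alpha/4) / K.  It lies in the unit ball (use
   0 below n and the network itself above n), and m samples miss at least one of m + 1
   disjoint translates. *)
Require Import Defs.
From mathcomp Require Import all_boot all_order all_algebra.
From mathcomp Require Import all_classical all_reals all_analysis ess_sup_inf.
From mathcomp Require Import zify ring lra.
Import Order.TTheory GRing.Theory Num.Theory.
Import numFieldNormedType.Exports.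
Local Open Scope classical_set_scope.
Local Open Scope ring_scope.
Set Implicit Arguments.
Unset Strict Implicit.
Unset Printing Implicit Defensive.

(** * The essential supremum of a continuous function on the cube *)

Section CubeLinfty.
Variables (R : realType) (d : nat).
Implicit Types f : unit_cube R d -> R.

(** Continuity in epsilon-delta form for the coordinatewise distance, so that a small box around [x]
    can be used directly; [cube_continuousP] ties it to the topology of the subtype. *)
Definition coord_continuous_at f (x : unit_cube R d) : Prop :=
  forall e : R, 0 < e -> exists2 dl : R, 0 < dl & forall y : unit_cube R d,
    (forall i, `|val y i 0 - val x i 0| < dl) -> `|f y - f x| < e.

Definition tuple_box n (a b : 'I_n -> R) : set (n.-tuple (measurableTypeR R)) :=
  [set t | forall i, a i <= tnth t i <= b i].

(** The induction follows the construction of the measure: the preimage of a box under [tuple_cons]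
    is an interval times a lower-dimensional box. Measurability is carried along because the product
    formula for rectangles asks for it. *)
Lemma lebesgue_tuple_box_gt0 n (a b : 'I_n -> R) : (forall i, a i < b i) ->
  measurable (tuple_box a b) /\ (0 < @lebesgue_tuple R n (tuple_box a b))%E.
Proof.
elim: n a b => [|n IH] a b ab.
  have -> : tuple_box a b = setT by apply/seteqP; split => // t _ [].
  by split => //=; rewrite diracT.
have [mB B0] := IH (fun i => a (lift ord0 i)) (fun i => b (lift ord0 i))
  (fun i => ab _).
have -> : tuple_box a b =
    (fun t => @thead _ _ t) @^-1` `[a ord0, b ord0]%classic `&`
    (fun t : n.+1.-tuple (measurableTypeR R) => [tuple of behead t]) @^-1`
    (tuple_box (fun i => a (lift ord0 i)) (fun i => b (lift ord0 i))).
  apply/seteqP; split => t /=.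
    move=> H; split; first by rewrite /= in_itv /=; exact: H.
    by move=> i; rewrite tnth_behead (_ : inord _ = lift ord0 i)//;
       apply/val_inj; rewrite /= inordK// ltnS.
  rewrite in_itv /= => -[H0 H] i.
  case: (unliftP ord0 i) => [j ->|->//].
  have := H j; rewrite tnth_behead (_ : inord _ = lift ord0 j)//.
  by apply/val_inj; rewrite /= inordK// ltnS.
split.
  apply: measurableI.
    rewrite -[X in measurable X]setTI; apply: measurable_tnth => //.
  rewrite -[X in measurable X]setTI; exact: measurable_behead.
rewrite /= /lebesgue_tuple_step /pushforward.
set X := (_ @^-1` _).
have -> : X = `[a ord0, b ord0]%classic `*`
    tuple_box (fun i => a (lift ord0 i)) (fun i => b (lift ord0 i)).
  apply/seteqP; split => -[x t]; rewrite /X /tuple_cons /preimage /=.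
    move=> [H1 H2]; split => //=.
    by move=> i; have := H2 i; rewrite !(tnth_nth 0).
  move=> [H1 H2]; split => //=.
  by move=> i; have := H2 i; rewrite !(tnth_nth 0).
rewrite product_measure1E//; apply: mule_gt0 => //.
have := lebesgue_measure_itv `[a ord0, b ord0]; rewrite /= lte_fin ab => ->.
by rewrite -EFinB lte_fin subr_gt0.
Qed.

Lemma lebesgue_tupleT_gt0 n : (0 < @lebesgue_tuple R n setT)%E.
Proof.
have [mB B0] := lebesgue_tuple_box_gt0 (fun _ : 'I_n => @ltr01 R).
by apply: lt_le_trans B0 _; apply: le_measure; rewrite ?inE.
Qed.

(** If [|f x|] exceeded r, continuity would make |f| exceed r on a box of positive measure, which
    cannot sit in a null set. *)
Lemma Linfty_norm_ge f x (r : R) : coord_continuous_at f x ->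
  (Linfty_norm f <= r%:E)%E -> `|f x| <= r.
Proof.
move=> fc; rewrite /Linfty_norm unlock lebesgue_tupleT_gt0.
move=> /ess_supP[N [mN N0 sN]]; rewrite leNgt; apply/negP => rx.
have [dl dl0 H] := fc (`|f x| - r) ltac:(by rewrite subr_gt0).
have x01 i : 0 <= val x i 0 <= 1 by have := set_valP x; exact.
pose h := Num.min (dl / 2) 1.
have h0 : 0 < h by rewrite lt_min divr_gt0 ?ltr01.
(* The box must stay inside the cube: its side h / 2, at most 1/2, extends to the right of a
   coordinate in the lower half of [0,1] and to the left otherwise. *)
pose a i := if val x i 0 <= 2^-1 then val x i 0 else val x i 0 - h / 2.
pose b i := a i + h / 2.
have hdl : h / 2 < dl.
  by have : h <= dl / 2 by [rewrite ge_min lexx]; lra.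
have h1 : h <= 1 by rewrite ge_min lexx orbT.
have [mB B0] := @lebesgue_tuple_box_gt0 d a b
  ltac:(by move=> i; rewrite /b ltrDl divr_gt0).
suff BN : tuple_box a b `<=` N.
  have : (lebesgue_tuple R d (tuple_box a b) <= lebesgue_tuple R d N)%E.
    by apply: le_measure; rewrite ?inE.
  by rewrite N0 leNgt B0.
move=> t tB; apply: sN => /=.
pose y0 : 'cV[R]_d := \col_i tnth t i.
have tB' i : val x i 0 - h / 2 <= tnth t i <= val x i 0 + h / 2 /\ 0 <= tnth t i <= 1.
  have := tB i; have := x01 i; rewrite /b /a; case: ifP => [|/negbT]; rewrite -?ltNge; lra.
have y01 : unit_cube R d y0 by move=> i; rewrite mxE; case: (tB' i).
pose y : unit_cube R d := exist _ y0 (mem_set y01).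
have -> : zero_ext f y0 = f y.
  by rewrite /zero_ext (_ : y0 = val y)// valK.
have /H : forall i, `|val y i 0 - val x i 0| < dl.
  by move=> i; rewrite /= mxE; have [+ _] := tB' i; rewrite ltr_norml; lra.
move=> yx; apply/negP; rewrite -ltNge lte_fin.
by have := ler_normB (f y) (f y - f x); rewrite opprB addrC subrK; lra.
Qed.

Lemma Linfty_norm_le f (r : R) : 0 <= r -> (forall x, `|f x| <= r) ->
  (Linfty_norm f <= r%:E)%E.
Proof.
move=> r0 fr; rewrite /Linfty_norm unlock lebesgue_tupleT_gt0.
apply/ess_supP; apply: nearW => t /=; rewrite lee_fin /zero_ext.
by case: insub => [x|] /=; rewrite ?normr0.
Qed.

Lemma cube_continuousP f :
  continuous f <-> forall x, coord_continuous_at f x.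
Proof.
split=> [cf x e e0|cf x].
  have /cvgr_distC_lt /(_ e e0) := cf x.
  rewrite /= nbhsE /= => -[U [[V oV <-] /= Vx] UE].
  have : nbhs (val x) V by apply: open_nbhs_nbhs.
  move=> [P Px PV].
  (* A neighbourhood of matrices is a product of neighbourhoods of the entries; having finitely many
     coordinates gives one radius for all. *)
  have : \forall dl \near 0^'+, forall i, `](val x i 0 - dl), (val x i 0 + dl)[%classic `<=` P i 0.
    apply: filter_forall => i.
    have /nbhs_ballP[dl /= dl0 H] := Px i 0.
    near=> q.
    move=> z /=; rewrite in_itv /= => zq; apply: H; rewrite /ball /= ltr_norml.
    have : q < dl by near: q; apply: nbhs_right_lt.
    lra.
  move=> Hn.
  near (0:R)^'+ => dl.
  exists dl => // y yx; apply: UE; apply: PV => i j; rewrite ord1.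
  have : forall i, `](val x i 0 - dl), (val x i 0 + dl)[%classic `<=` P i 0.
    by near: dl.
  by apply; rewrite /= in_itv /=; have := yx i; rewrite ltr_norml; lra.
apply: (iffRL (@cvgrPdistC_lt _ _ _ (nbhs x) (nbhs_filter x) f (f x))) => e e0.
have [dl dl0 H] := cf x e e0.
have : nbhs (val x) [set v : 'cV[R]_d | forall i, `|v i 0 - val x i 0| < dl].
  exists (fun i j => ball (val x i j) dl) => [i j|v Hv i]; first exact: nbhsx_ballx.
  by have := Hv i 0; rewrite /ball /= distrC.
move=> /(@initial_continuous _ _ set_val x) /=.
by apply: (@filterS _ (nbhs x) (nbhs_filter x)) => y; exact: H.
Unshelve. all: by end_near. Qed.

End CubeLinfty.

(** * Lipschitz bounds for networks *)

(** The recursion e -> 2 e + 1 followed by the Lipschitz exponent from one layer to the next. *)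
Lemma expn2_subn1 n : (0 < n)%N -> (2 ^ n - 1 = ((2 ^ n.-1 - 1) * 2).+1)%N.
Proof.
case: n => // n _; rewrite expnS /=.
by have := expn_gt0 2 n; move: (2 ^ n)%N => q; lia.
Qed.

Section NetworkLipschitz.
Variable R : realType.

(** Squared Euclidean norm; stating all Lipschitz bounds for squares avoids square roots. *)
Definition sqnorm n (v : 'cV[R]_n) : R := \sum_i v i 0 ^+ 2.

Lemma sqnorm_ge0 n (v : 'cV[R]_n) : 0 <= sqnorm v.
Proof. by apply: sumr_ge0 => i _; exact: sqr_ge0. Qed.

(** Cauchy-Schwarz, from Lagrange's identity: the double sum of squares is twice the difference of
    the two sides. *)
Lemma sqr_sum_mul_le n (a b : 'I_n -> R) :
  (\sum_i a i * b i) ^+ 2 <= (\sum_i a i ^+ 2) * (\sum_i b i ^+ 2).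
Proof.
suff H : 0 <= \sum_i \sum_j (a i * b j - a j * b i) ^+ 2.
  move: H; have -> : \sum_i \sum_j (a i * b j - a j * b i) ^+ 2 =
     (\sum_i a i ^+ 2) * (\sum_i b i ^+ 2) *+ 2 - (\sum_i a i * b i) ^+ 2 *+ 2.
    have E1 : (\sum_i a i ^+ 2) * (\sum_i b i ^+ 2) = \sum_i \sum_j a i ^+ 2 * b j ^+ 2.
      by rewrite mulr_suml; apply: eq_bigr => i _; rewrite mulr_sumr.
    have E2 : (\sum_i a i ^+ 2) * (\sum_i b i ^+ 2) = \sum_i \sum_j a j ^+ 2 * b i ^+ 2.
      by rewrite E1 exchange_big.
    have E3 : (\sum_i a i * b i) ^+ 2 = \sum_i \sum_j (a i * b i) * (a j * b j).
      by rewrite expr2 mulr_suml; apply: eq_bigr => i _; rewrite mulr_sumr.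
    rewrite mulr2n {1}E1 E2 E3 -sumrMnl -sumrN -!big_split /=.
    apply: eq_bigr => i _; rewrite -sumrMnl -sumrN -!big_split /=.
    by apply: eq_bigr => j _; ring.
  by rewrite -mulrnBl pmulrn_lge0// subr_ge0.
by do 2 (apply: sumr_ge0 => ? _); exact: sqr_ge0.
Qed.

Lemma mx_entry_le_norm m n (A : 'M[R]_(m, n)) i j : `|A i j| <= `|A|.
Proof.
rewrite {2}/Num.Def.normr /= mx_normrE.
exact: (le_bigmax 0 (fun p : 'I_m * 'I_n => `|A p.1 p.2|) (i, j)).
Qed.

(** Only nonzero entries contribute to the Frobenius norm; thus the weight count, and not the layer
    widths, enters the Lipschitz constant. *)
Lemma sqsum_mx_le m n (A : 'M[R]_(m, n)) (c : R) : `|A| <= c ->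
  \sum_i \sum_j A i j ^+ 2 <= (nnz A)%:R * c ^+ 2.
Proof.
move=> Ac; rewrite pair_big /= (bigID (fun p => A p.1 p.2 != 0)) /= [X in _ + X]big1 ?addr0.
  rewrite /nnz mulr_natl -sumr_const.
  rewrite (eq_bigl (fun p => p \in [set ij : 'I_m * 'I_n | A ij.1 ij.2 != 0])); last first.
    by move=> p; apply/idP/idP => [Ap|]; [rewrite inE|rewrite inE].
  apply: ler_sum => p _; rewrite -real_normK ?num_real// ler_sqr ?nnegrE//.
    by apply: le_trans Ac; exact: mx_entry_le_norm.
  by apply: le_trans Ac.
by move=> p; rewrite negbK => /eqP ->; rewrite expr0n.
Qed.

Lemma sqnorm_mulmx_le m n (A : 'M[R]_(m, n)) (v : 'cV[R]_n) :
  sqnorm (A *m v) <= (\sum_i \sum_j A i j ^+ 2) * sqnorm v.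
Proof.
rewrite /sqnorm mulr_suml; apply: ler_sum => i _; rewrite mxE.
exact: sqr_sum_mul_le.
Qed.

Lemma sqnormD_le n (v w : 'cV[R]_n) :
  sqnorm (v + w) <= 2 * sqnorm v + 2 * sqnorm w.
Proof.
rewrite /sqnorm !mulr_sumr -big_split /=; apply: ler_sum => i _.
by rewrite !mxE; have := sqr_ge0 (v i 0 - w i 0); lra.
Qed.

Lemma requ_le_sqr (x : R) : requ x <= x ^+ 2.
Proof.
rewrite /requ /Num.max; case: ltP => // _.
by rewrite expr0n sqr_ge0.
Qed.

Lemma requ_ge0 (x : R) : 0 <= requ x. Proof. exact: sqr_ge0. Qed.

(** A sum of fourth powers is at most the square of the sum of squares, so no factor depending on
    the width appears. *)
Lemma sqnorm_requ_le n (v : 'cV[R]_n) :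
  sqnorm (map_mx (@requ R) v) <= sqnorm v ^+ 2.
Proof.
rewrite /sqnorm [leRHS]expr2 mulr_suml; apply: ler_sum => i _; rewrite mxE.
rewrite expr2; apply: ler_pM; rewrite ?requ_ge0 ?requ_le_sqr//.
apply: le_trans (requ_le_sqr _) _; rewrite (bigD1 i)//= lerDl.
by apply: sumr_ge0 => j _; exact: sqr_ge0.
Qed.

(** For the positive parts p and q, factor p^2 - q^2 = (p - q)(p + q), where |p - q| <= |x - y| and
    (p + q)^2 <= 2 (p^2 + q^2). *)
Lemma sqr_requB_le (x y : R) :
  (requ x - requ y) ^+ 2 <= 2 * (x - y) ^+ 2 * (x ^+ 2 + y ^+ 2).
Proof.
have [p [pE px p0]] : exists p : R, [/\ requ x = p ^+ 2, p ^+ 2 <= x ^+ 2 & p = Num.max 0 x].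
  by exists (Num.max 0 x); split => //; exact: requ_le_sqr.
have [q [qE qy q0]] : exists q : R, [/\ requ y = q ^+ 2, q ^+ 2 <= y ^+ 2 & q = Num.max 0 y].
  by exists (Num.max 0 y); split => //; exact: requ_le_sqr.
have pq : `|p - q| <= `|x - y|.
  rewrite p0 q0 /Num.max ler_norml.
  have := ler_norm (x - y); have := ler_norm (- (x - y)); rewrite normrN.
  by case: (ltP 0 x); case: (ltP 0 y) => ? ? ? ?; apply/andP; split; lra.
have pq2 : (p - q) ^+ 2 <= (x - y) ^+ 2.
  by rewrite -(real_normK (num_real (p - q))) -(real_normK (num_real (x - y))) ler_sqr ?nnegrE.
have -> : (requ x - requ y) ^+ 2 = (p - q) ^+ 2 * (p + q) ^+ 2 by rewrite pE qE; ring.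
have -> : 2 * (x - y) ^+ 2 * (x ^+ 2 + y ^+ 2) = (x - y) ^+ 2 * (2 * (x ^+ 2 + y ^+ 2)) by ring.
apply: ler_pM; rewrite ?sqr_ge0//.
by have := sqr_ge0 (p - q); lra.
Qed.

Lemma sqnorm_requB_le n (v w : 'cV[R]_n) :
  sqnorm (map_mx (@requ R) v - map_mx (@requ R) w) <=
  2 * sqnorm (v - w) * (sqnorm v + sqnorm w).
Proof.
rewrite /sqnorm -big_split /= mulr_sumr; apply: ler_sum => i _; rewrite !mxE.
apply: le_trans (sqr_requB_le _ _) _; rewrite ler_wpM2r ?addr_ge0 ?sqr_ge0//.
rewrite ler_wpM2l// (bigD1 i)//= !mxE lerDl.
by apply: sumr_ge0 => j _; rewrite sqr_ge0.
Qed.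

(* With U = 16 M^2 V the bounds propagate as U -> U^2 through a layer, which
   gives the exponent 1 + 2 + ... + 2^(L-2). *)
Lemma sqnorm_realizationB_le (c M V : R) dout din (Phi : network R dout din)
    (x y : 'cV[R]_din) :
  0 <= c -> nn_norm Phi <= c -> (nn_weights Phi)%:R * c ^+ 2 <= M ->
  1 <= M -> 1 <= V -> sqnorm x <= V -> sqnorm y <= V ->
  sqnorm (realization Phi x - realization Phi y) <=
    M * (16 * M ^+ 2 * V) ^+ (2 ^ (nn_depth Phi).-1 - 1) * sqnorm (x - y).
Proof.
move=> c0; elim: Phi V x y => {din} [din A b|din k k0 A b Psi IH] V x y /=.
  rewrite ge_max => /andP[Ac _] W M1 V1 xV yV.
  rewrite expn0 subnn expr0 mulr1 opprD addrACA subrr addr0 -mulmxBr.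
  apply: le_trans (sqnorm_mulmx_le _ _) _; rewrite ler_wpM2r ?sqnorm_ge0//.
  apply: le_trans (sqsum_mx_le Ac) _; apply: le_trans W.
  by rewrite ler_wpM2r ?sqr_ge0// ler_nat leq_addr.
rewrite !ge_max => /andP[/andP[Ac bc] Psic] W M1 V1 xV yV.
have W_le w : (w <= nnz A + nnz b + nn_weights Psi)%N -> w%:R * c ^+ 2 <= M.
  by move=> w_le; apply: le_trans W; rewrite ler_wpM2r ?sqr_ge0// ler_nat.
have WA : (nnz A)%:R * c ^+ 2 <= M by rewrite W_le// -addnA leq_addr.
have Wb : (nnz b)%:R * c ^+ 2 <= M by rewrite W_le// addnAC leq_addl.
have WP : (nn_weights Psi)%:R * c ^+ 2 <= M by rewrite W_le// leq_addl.
have bM : sqnorm b <= M.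
  apply: le_trans Wb; apply: le_trans (sqsum_mx_le bc).
  by rewrite /sqnorm; apply: ler_sum => i _; rewrite big_ord1.
have AM v : sqnorm (A *m v) <= M * sqnorm v.
  apply: le_trans (sqnorm_mulmx_le _ _) _; rewrite ler_wpM2r ?sqnorm_ge0//.
  exact: le_trans (sqsum_mx_le Ac) WA.
have TV v : sqnorm v <= V -> sqnorm (A *m v + b) <= 4 * M * V.
  move=> vV; apply: le_trans (sqnormD_le _ _) _.
  have := AM v; have : M * sqnorm v <= M * V by rewrite ler_wpM2l//; lra.
  have : M <= M * V by rewrite ler_peMr//; lra.
  by rewrite -mulrA; lra.
(* The affine map sends the ball of squared radius V into that of squared radius 4 M V, and ReQU
   squares this bound. *)
pose V' := 16 * M ^+ 2 * V ^+ 2.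
have RV v : sqnorm v <= V -> sqnorm (map_mx (@requ R) (A *m v + b)) <= V'.
  move=> /TV vV; apply: le_trans (sqnorm_requ_le _) _.
  rewrite (_ : V' = (4 * M * V) ^+ 2); last by rewrite /V'; ring.
  by rewrite ler_sqr ?nnegrE ?sqnorm_ge0//; apply: le_trans vV; exact: sqnorm_ge0.
have M2 : 1 <= M ^+ 2 by rewrite expr_ge1// (le_trans _ M1).
have V2 : 1 <= V ^+ 2 by rewrite expr_ge1// (le_trans _ V1).
have MV2 : 1 <= M ^+ 2 * V ^+ 2 by rewrite mulr_ege1.
have V'1 : 1 <= V' by rewrite /V' -mulrA; lra.
apply: le_trans (IH V' _ _ Psic WP M1 V'1 (RV _ xV) (RV _ yV)) _.
set U := 16 * M ^+ 2 * V.
have U0 : 0 <= U by rewrite /U !mulr_ge0 ?sqr_ge0//; lra.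
have -> : 16 * M ^+ 2 * V' = U ^+ 2 by rewrite /U /V'; ring.
have D : sqnorm (map_mx (@requ R) (A *m x + b) - map_mx (@requ R) (A *m y + b))
    <= U * sqnorm (x - y).
  apply: le_trans (sqnorm_requB_le _ _) _.
  rewrite opprD addrACA subrr addr0 -mulmxBr.
  have := TV _ xV; have := TV _ yV => H1 H2.
  apply: (@le_trans _ _ (2 * (M * sqnorm (x - y)) * (8 * M * V))).
    apply: ler_pM; rewrite ?addr_ge0 ?mulr_ge0 ?sqnorm_ge0//.
      by rewrite ler_wpM2l.
    lra.
  by rewrite /U le_eqVlt; apply/orP; left; apply/eqP; ring.
have Psi0 : (0 < nn_depth Psi)%N by case: (Psi).
have -> : U ^+ (2 ^ nn_depth Psi - 1) = U * (U ^+ 2) ^+ (2 ^ (nn_depth Psi).-1 - 1).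
  by rewrite (expn2_subn1 Psi0) exprS mulnC exprM.
set Z := (U ^+ 2) ^+ _.
have MZ : 0 <= M * Z by rewrite mulr_ge0 ?exprn_ge0//; lra.
rewrite [leRHS](_ : _ = M * Z * (U * sqnorm (x - y))); last by ring.
by rewrite ler_wpM2l.
Qed.

End NetworkLipschitz.

(** * Elements of the unit ball *)

Section UnitBall.
Variables (R : realType) (d : nat).

Lemma cube_coord_bound (x : unit_cube R d) i : 0 <= val x i 0 <= 1.
Proof. exact: (set_valP x). Qed.

Lemma sqnorm_cube_le (x : unit_cube R d) : sqnorm (val x) <= d%:R.
Proof.
rewrite /sqnorm -[X in X%:R]card_ord -sumr_const; apply: ler_sum => i _.
by have /andP[? ?] := cube_coord_bound x i; rewrite expr_le1.
Qed.

Lemma sqlipschitz_continuous (f : unit_cube R d -> R) (K : R) :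
  (forall x y, (f x - f y) ^+ 2 <= K * sqnorm (val x - val y)) -> continuous f.
Proof.
move=> fK; apply/cube_continuousP => x e e0.
(* The summand 1 makes K' exceed max(K, 0) d and be at least 1, so max(K, 0) d (e / K')^2 < e^2. *)
pose K' := Num.max K 0 * d%:R + 1.
have K0 : 0 <= Num.max K 0 by rewrite le_max lexx orbT.
have K'1 : 1 <= K' by rewrite /K' lerDr mulr_ge0.
have K'0 : 0 < K' by lra.
exists (e / K') => [|y yx]; first by rewrite divr_gt0.
rewrite -ltr_sqr ?nnegrE ?(ltW e0)// real_normK ?num_real//.
apply: le_lt_trans (fK _ _) _.
apply: (@le_lt_trans _ _ (Num.max K 0 * (d%:R * (e / K') ^+ 2))).
  apply: (@le_trans _ _ (Num.max K 0 * sqnorm (val y - val x))).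
    by rewrite ler_wpM2r ?sqnorm_ge0// le_max lexx.
  rewrite ler_wpM2l// /sqnorm -[X in X%:R]card_ord mulr_natl -sumr_const.
  apply: ler_sum => i _; rewrite !mxE -(real_normK (num_real (_ - _))).
  by rewrite ler_sqr ?nnegrE ?(ltW (divr_gt0 e0 K'0))// ltW.
rewrite mulrA exprMn mulrCA -[ltRHS]mulr1 ltr_pM2l ?exprn_gt0//.
rewrite exprVn ltr_pdivrMr ?exprn_gt0// mul1r.
by rewrite (lt_le_trans (_ : _ < K'))// ?/K' ?ltrDl// expr2 ler_peMr// ltW.
Qed.

(** The cube lies in the ball of squared radius d, and the base 16 M^2 d is at least 1, so the depth
    may be replaced by an upper bound L. *)
Lemma realization_cube_sqlipschitz (Phi : network R 1 d) (c M : R) (x y : unit_cube R d) L :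
  (0 < d)%N -> 0 <= c -> nn_norm Phi <= c -> (nn_weights Phi)%:R * c ^+ 2 <= M ->
  1 <= M -> (nn_depth Phi <= L)%N ->
  (realization Phi (val x) 0 0 - realization Phi (val y) 0 0) ^+ 2 <=
    M * (16 * M ^+ 2 * d%:R) ^+ (2 ^ L.-1 - 1) * sqnorm (val x - val y).
Proof.
move=> d0 c0 Pc Pw M1 PL.
have d1 : 1 <= d%:R :> R by rewrite ler1n.
have := sqnorm_realizationB_le c0 Pc Pw M1 d1 (sqnorm_cube_le x) (sqnorm_cube_le y).
rewrite {1}/sqnorm big_ord1 !mxE => /le_trans; apply.
rewrite ler_wpM2r ?sqnorm_ge0// ler_wpM2l//; first lra.
apply: ler_weXn2l; last by rewrite leq_sub2r// leq_pexp2l//; lia.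
have M2 : 1 <= M ^+ 2 by rewrite expr_ge1//; lra.
by rewrite mulr_ege1// mulr_ege1// ler1n.
Qed.

Lemma realization_cube_continuous (Phi : network R 1 d) :
  (0 < d)%N -> continuous (fun x : unit_cube R d => realization Phi (val x) 0 0).
Proof.
move=> d0; set c := Num.max 0 (nn_norm Phi).
have c0 : 0 <= c by rewrite le_max lexx.
pose M := Num.max 1 ((nn_weights Phi)%:R * c ^+ 2).
apply: sqlipschitz_continuous => x y.
apply: (@realization_cube_sqlipschitz Phi c M x y (nn_depth Phi)) => //.
- by rewrite le_max lexx orbT.
- by rewrite le_max lexx orbT.
- by rewrite le_max lexx.
Qed.

(** Neither infimum need be attained: the scale t is taken below 2 instead of 1 and the error below
    2 n^-alpha, whence the factor 4. The essential bound becomes pointwise because both functions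
    are continuous. *)
Lemma approx_unit_ball_network (alpha : R) (l c : nat -> \bar R) (u : Ccube R d) n :
  (0 < d)%N -> approx_unit_ball alpha l c u -> (0 < n)%N ->
  exists (Phi : network R 1 d) (t : R),
    [/\ 0 < t < 2, (nn_weights Phi <= n)%N, ((nn_depth Phi)%:R%:E <= l n)%E,
      ((nn_norm Phi)%:E <= c n)%E &
      forall x, `|u x - t * realization Phi (val x) 0 0| <= 4 * n%:R `^ (- alpha)].
Proof.
move=> d0 uU n0.
have n0R : 0 < n%:R :> R by rewrite ltr0n.
have /ereal_inf_lt [_ [t [t0 Gt] <-] t2] : (approx_norm alpha l c u < 2%:E)%E.
  by apply: le_lt_trans uU _; rewrite lte_fin; lra.
have p0 : 0 < n%:R `^ (- alpha) :> R by exact: powR_gt0.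
have /ereal_inf_lt[_ [_ [Phi [Pw Pd Pc ->]] <-] gl] :
    (best_error l c n (fun x => (u x / t)%R) < (2 * n%:R `^ (- alpha))%:E)%E.
  apply: (@le_lt_trans _ _ (n%:R `^ (- alpha))%:E); last by rewrite lte_fin; lra.
  have : ((n%:R `^ alpha)%:E * best_error l c n (fun x => (u x / t)%R) <= 1)%E.
    apply: le_trans Gt; rewrite le_max; apply/orP; right.
    by apply: ereal_sup_ubound; exists n.
  by rewrite powRN -lee_pdivlMl ?powR_gt0// mule1.
exists Phi, t; split => //; first by rewrite t0 -lte_fin.
move=> x.
have cf : continuous (fun x : unit_cube R d => u x / t - realization Phi (val x) 0 0).
  move=> z; apply: (cvgB (cvgM (@Ccube_continuous _ _ u z) (cvg_cst _))).
  exact: realization_cube_continuous.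
have := Linfty_norm_ge ((iffLR (cube_continuousP _)) cf x) (ltW gl).
rewrite lte_fin in t2.
have -> : u x - t * realization Phi (val x) 0 0 = t * (u x / t - realization Phi (val x) 0 0).
  by rewrite mulrBr mulrCA divff ?mulr1// gt_eqF.
rewrite normrM gtr0_norm// => H.
apply: (@le_trans _ _ (2 * (2 * n%:R `^ (- alpha)))); last by rewrite mulrA; lra.
by apply: ler_pM => //; exact: ltW.
Qed.

(** The error of an interpolating algorithm is at most the diameter of a set of elements with equal
    samples. The default 0 of [xget] occurs only for data that no element of [U] produces. *)
Lemma inf_alg_error_le (U : set (Ccube R d)) m (x : 'I_m -> unit_cube R d) (E : R) :
  (forall u v, U u -> U v -> (forall i, u (x i) = v (x i)) -> `|u - v| <= E) ->
  (ereal_inf [set alg_error U (@idfun (Ccube R d)) A | A in Alg (Y:=Ccube R d) m U] <= E%:E)%E.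
Proof.
move=> H.
pose Q (r : 'rV[R]_m) : Ccube R d := xget 0 [set v | U v /\ \row_i v (x i) = r].
apply: (@le_trans _ _ (alg_error U (@idfun (Ccube R d)) (fun u => Q (\row_i u (x i))))).
  by apply: ereal_inf_lbound; eexists; last reflexivity; exists x, Q.
apply: ge_ereal_sup => _ [u Uu <-]; rewrite lee_fin.
have [UQ Qu] : [set v | U v /\ \row_i v (x i) = \row_i u (x i)] (Q (\row_i u (x i))).
  by rewrite /Q; case: xgetP => // /(_ u) [].
apply: H => // i.
by have /matrixP/(_ 0 i) := Qu; rewrite !mxE.
Qed.

End UnitBall.

(** * Sampling on a grid *)

Section LowerBound.
Variable R : realType.

(** A finite supremum of integers is attained, and by monotonicity the sequence is constant from
    there on. The lower bound on the order uses [l n <= L]; the upper bound uses that depth L is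
    eventually available. *)
Lemma sup_pos_nat (l : nat -> \bar R) k :
  (forall n : nat, (0 < n)%N -> nat_ge_or_infty R k (l n)) ->
  nondecreasing_pos l -> (sup_pos l < +oo)%E ->
  exists L n0 : nat, [/\ (k <= L)%N, sup_pos l = L%:R%:E,
    forall n, (0 < n)%N -> (l n <= L%:R%:E)%E &
    forall n, (0 < n)%N -> (n0 <= n)%N -> l n = L%:R%:E].
Proof.
move=> lv lm ls.
have lub n : (0 < n)%N -> (l n <= sup_pos l)%E.
  by move=> n0; apply: ereal_sup_ubound; exists n.
have ln n : (0 < n)%N -> exists2 j : nat, (k <= j)%N & l n = j%:R%:E.
  move=> n0; case: (lv n n0) => [E|//].
  by have := lub n n0; rewrite E leye_eq => /eqP E'; rewrite E' ltxx in ls.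
pose P j := `[< exists2 n : nat, (0 < n)%N & l n = j%:R%:E >].
have exP : exists j, P j.
  by have [j _ E] := ln 1%N isT; exists j; apply/asboolP; exists 1%N.
have [s0 sE] : exists s, sup_pos l = s%:E.
  have [j _ E] := ln 1%N isT.
  have := lub 1%N isT; rewrite E.
  by move: ls; case: (sup_pos l) => // s _ _; exists s.
have bP j : P j -> (j <= Num.truncn s0)%N.
  move=> /asboolP[n n0 E]; have := lub n n0; rewrite E sE lee_fin => js.
  by rewrite truncn_ge_nat// (le_trans _ js).
have [L /asboolP[n1 n10 n1L] Lmax] := ex_maxnP exP bP.
have lL n : (0 < n)%N -> (l n <= L%:R%:E)%E.
  move=> n0; have [j _ E] := ln n n0; rewrite E lee_fin ler_nat Lmax//.
  by apply/asboolP; exists n.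
exists L, n1; split => //.
- by have [j kj E] := ln _ n10; move: n1L; rewrite E => -[] /eqP; rewrite eqr_nat => /eqP <-.
- apply/eqP; rewrite eq_le; apply/andP; split.
    by apply: ge_ereal_sup => _ [n n0 <-]; exact: lL.
  by rewrite -n1L lub.
- move=> n n0 n1n; apply/eqP; rewrite eq_le lL//= -n1L; exact: lm.
Qed.

Lemma powR_ge1 (a x : R) : 1 <= a -> 0 <= x -> 1 <= a `^ x.
Proof. by move=> a1 x0; rewrite -[leLHS](powRr0 a) ler_powR. Qed.

(** For kappa <= 0 the bound ln (2 n) >= ln 2 suffices; for kappa > 0 apply ln z < z to z = (2
    n)^(dl / kappa). *)
Lemma powR_ln_le (kappa dl : R) : 0 < dl -> exists2 C : R, 0 < C &
  forall n : nat, (0 < n)%N -> ln (2 * n%:R) `^ kappa <= C * n%:R `^ dl.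
Proof.
move=> dl0.
have ln20 : 0 < ln (2 : R) by rewrite ln_gt0//; lra.
have ln2n n : (0 < n)%N -> ln (2 : R) <= ln (2 * n%:R).
  move=> n0; rewrite ler_ln ?posrE ?mulr_gt0 ?ltr0n// ler_peMr// ler1n//.
have [k0|k0] := leP kappa 0.
  exists (ln 2 `^ kappa) => [|n n0]; first exact: powR_gt0.
  apply: (@le_trans _ _ (ln 2 `^ kappa)).
    rewrite -[kappa]opprK !(powRN _ (- kappa)) lef_pV2 ?posrE ?powR_gt0//; last first.
      exact: lt_le_trans (ln2n n n0).
    apply: ge0_ler_powR; rewrite ?nnegrE ?oppr_ge0 ?ln2n// ltW//.
    exact: lt_le_trans (ln2n n n0).
  by rewrite ler_peMr ?powR_ge0// powR_ge1 ?ler1n// ltW.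
exists ((kappa / dl) `^ kappa * 2 `^ dl) => [|n n0].
  by rewrite mulr_gt0// powR_gt0// divr_gt0.
have n2 : 0 < 2 * n%:R :> R by rewrite mulr_gt0 ?ltr0n.
rewrite -mulrA -powRM//.
have -> : (2 * n%:R) `^ dl = ((2 * n%:R) `^ (dl / kappa)) `^ kappa :> R.
  by rewrite -powRrM divfK ?gt_eqF.
rewrite -powRM ?powR_ge0// ?divr_ge0 ?(ltW k0) ?(ltW dl0)//.
apply: ge0_ler_powR; rewrite ?nnegrE ?mulr_ge0 ?powR_ge0 ?divr_ge0 ?(ltW k0) ?(ltW dl0)//.
- by apply/ltW; exact: lt_le_trans (ln2n n n0).
- by rewrite invr_ge0 ltW.
have E : ln (2 * n%:R) = (kappa / dl) * ln ((2 * n%:R) `^ (dl / kappa)) :> R.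
  by rewrite ln_powR; field; rewrite !gt_eqF.
by rewrite E ler_pM2l ?divr_gt0//; apply/ltW/ln_sublinear/powR_gt0.
Qed.

Lemma exists_root_nat d m : (0 < d)%N -> (0 < m)%N ->
  exists2 g : nat, (0 < g)%N & ((g ^ d <= m) && (m < g.+1 ^ d))%N.
Proof.
move=> d0 m0.
have exP : exists g, (fun g => g ^ d <= m)%N g by exists 1%N; rewrite exp1n.
have bP g : (g ^ d <= m)%N -> (g <= m)%N.
  by apply: leq_trans; case: g => // g; rewrite -{1}(expn1 g.+1) leq_pexp2l.
have [g gm gmax] := ex_maxnP exP bP; exists g.
  by apply: gmax; rewrite exp1n.
by rewrite gm ltnNge; apply/negP => /gmax; rewrite ltnn.
Qed.


Lemma cube_grid d g m : (0 < g)%N -> (g ^ d <= m)%N ->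
  exists xs : 'I_m -> unit_cube R d, forall x : unit_cube R d, exists i, forall j,
    `|val x j 0 - val (xs i) j 0| <= g%:R^-1.
Proof.
case: g => // g _ gm.
have g0 : 0 < g.+1%:R :> R by [].
pose T : finType := {ffun 'I_d -> 'I_g.+1}.
have TE : #|T| = (g.+1 ^ d)%N by rewrite card_ffun !card_ord.
pose pt0 (f : T) : 'cV[R]_d := \col_j ((f j)%:R / g.+1%:R).
have pt01 f : unit_cube R d (pt0 f).
  move=> j; rewrite mxE divr_ge0//= ler_pdivrMr// mul1r ler_nat.
  exact/ltnW/ltn_ord.
pose pt f : unit_cube R d := exist _ (pt0 f) (mem_set (pt01 f)).
(* Indices beyond the number of grid nodes all receive this node. *)
pose f0 : T := [ffun=> ord0].
exists (fun i => pt (nth f0 (enum T) i)) => x.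
(* Each coordinate is rounded down to the grid; the cap at g matters only for the coordinate 1,
   whose error is then exactly one mesh width. *)
pose f : T := [ffun j => inord (minn (Num.truncn (g.+1%:R * val x j 0)) g)].
have fm : (index f (enum T) < m)%N.
  by rewrite (leq_trans _ gm)// -TE cardE index_mem mem_enum.
exists (Ordinal fm) => j; rewrite /= nth_index ?mem_enum// mxE ffunE.
rewrite inordK ?ltnS ?geq_minr//.
have /andP[x0 x1] := cube_coord_bound x j.
have /andP[k1 k2] := truncn_itv (mulr_ge0 (ltW g0) x0).
move: k1 k2; set k := Num.truncn _ => k1 k2.
rewrite -(ler_pM2l g0) -{1}(gtr0_norm g0) -normrM mulrBr.
have -> : g.+1%:R * ((minn k g)%:R / g.+1%:R) = (minn k g)%:R :> R by field; rewrite gt_eqF.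
rewrite mulfV ?gt_eqF// ler_norml /minn; case: ltnP => kg.
  by rewrite -natr1 in k2; lra.
have gx : g.+1%:R * \val x j 0 <= g.+1%:R by rewrite ler_piMr// ltW.
have : g%:R <= k%:R :> R by rewrite ler_nat.
by rewrite -natr1 in gx *; lra.
Qed.

(** Since [beta] is strictly below the claimed order, the exponent theta can be enlarged by some
    [dl] that absorbs the logarithm in c. *)
Lemma inf_alg_error_powR_le d (alpha theta kappa beta : R) (l c : nat -> \bar R) L :
  (0 < d)%N -> 0 < alpha -> 0 <= theta -> (0 < L)%N ->
  asymp c (fun n => (n%:R `^ theta * (ln (2 * n%:R)) `^ kappa)%:E) ->
  (forall n, (0 < n)%N -> (l n <= L%:R%:E)%E) ->
  0 <= beta -> beta * (alpha + (2 ^+ L - 1) * (theta + 1 / 2)) < alpha / d%:R ->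
  exists2 C : R, 0 < C & forall m : nat, (0 < m)%N ->
    (ereal_inf [set alg_error (approx_unit_ball alpha l c) (@idfun (Ccube R d)) A |
        A in Alg (Y:=Ccube R d) m (approx_unit_ball alpha l c)]
      <= (C * m%:R `^ (- beta))%:E)%E.
Proof.
move=> d0 al0 th0 L0 [C1 [C1' [C10 _ cb]]] lL be0 beta_lt.
pose K := (2 ^ L - 1)%N.
have KE : 2 ^+ L - 1 = K%:R :> R by rewrite natrB ?expn_gt0// natrX.
have K0 : 0 < K%:R :> R.
  by rewrite -KE subr_gt0 -natrX ltr1n -{1}(expn0 2) ltn_exp2l.
rewrite KE in beta_lt.
(* The gap in the hypothesis on [beta], divided by K (beta + 1) rather than K beta, which could
   vanish; [ga_le] follows. *)
pose dl := (alpha / d%:R - beta * (alpha + K%:R * (theta + 1 / 2))) / (K%:R * (beta + 1)).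
have be1 : 0 < beta + 1 by lra.
have dl0 : 0 < dl by rewrite divr_gt0 ?subr_gt0// mulr_gt0.
pose ga := theta + 1 / 2 + dl.
have ga0 : 0 < ga by rewrite /ga; lra.
have ga_le : beta * (alpha + K%:R * ga) <= alpha / d%:R.
  have E : K%:R * (beta + 1) * dl = alpha / d%:R - beta * (alpha + K%:R * (theta + 1 / 2)).
    by rewrite /dl mulrC divfK// gt_eqF// mulr_gt0.
  have Kdl : 0 < K%:R * dl by rewrite mulr_gt0.
  by rewrite /ga; nra.
have [C2 C20 lnC] := powR_ln_le kappa dl0.
(* The maximum with 1 ensures M >= 1 below, as the Lipschitz bound requires. *)
pose CC := Num.max 1 (C1 * C2).
have CC1 : 1 <= CC by rewrite le_max lexx.
pose cn (n : nat) := CC * n%:R `^ (theta + dl).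
have c_le n : (0 < n)%N -> (c n <= (cn n)%:E)%E.
  move=> n0; have [+ _] := cb n n0; move=> /le_trans; apply.
  rewrite -EFinM lee_fin /cn powRD; last by rewrite pnatr_eq0 -lt0n n0 implybT.
  apply: (@le_trans _ _ (C1 * (n%:R `^ theta * (C2 * n%:R `^ dl)))).
    by rewrite ler_pM2l// ler_wpM2l ?powR_ge0// lnC.
  rewrite (_ : C1 * _ = C1 * C2 * (n%:R `^ theta * n%:R `^ dl)); last by ring.
  by rewrite ler_wpM2r ?mulr_ge0 ?powR_ge0// le_max lexx orbT.
pose E := (2 ^ L.-1 - 1)%N.
(* Collects the constants from M^K, from (16 d)^E, from n <= 2 x and from the mesh of the grid. As
   C3 <= (C3 + 1)^2, the constant C3 + 1 serves in place of a square root. *)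
pose C3 := CC ^+ (2 * K) * (16 * d%:R) ^+ E * 2 `^ (2 * ga * K%:R) * (4 * d%:R).
have C30 : 0 <= C3.
  by rewrite /C3 !mulr_ge0 ?exprn_ge0 ?powR_ge0//; lra.
have CC0 : 0 <= CC := le_trans ler01 CC1.
have C31 : 0 <= C3 + 1 by rewrite addr_ge0.
have C3sq : C3 <= (C3 + 1) ^+ 2 by move: C30; clear; nra.
have gaK0 : 0 <= 2 * ga * K%:R by rewrite !mulr_ge0// ltW.
(* Twice the constant in [near], which is made of two approximation errors 4 n^-alpha and of t < 2
   times the variation of the network. *)
exists (16 + 4 * (C3 + 1)) => [|m m0]; first by move: C31; clear; lra.
have m0R : 0 < m%:R :> R by rewrite ltr0n.
have m1R : 1 <= m%:R :> R by rewrite ler1n.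
have [g g0 /andP[gm mg]] := exists_root_nat d0 m0.
have [xs xsP] := cube_grid g0 gm.
pose x := m%:R `^ (beta / alpha) : R.
have x1 : 1 <= x by rewrite powR_ge1// divr_ge0// ltW.
have x0 : 0 <= x := le_trans ler01 x1.
(* As x >= 1, x <= n <= 2 x: the first inequality gives n^-alpha <= m^-beta, the second controls the
   Lipschitz constant. *)
pose n := (Num.truncn x).+1.
have nx : x <= n%:R by rewrite ltW// /n truncnS_gt.
have nx2 : n%:R <= 2 * x.
  have : (Num.truncn x)%:R <= x by rewrite truncn_le; lra.
  by rewrite /n -natr1; lra.
have n_pow : n%:R `^ (- alpha) <= m%:R `^ (- beta).
  rewrite !powRN lef_pV2 ?posrE ?powR_gt0//.
  have -> : m%:R `^ beta = x `^ alpha by rewrite /x -powRrM divfK ?gt_eqF.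
  by rewrite ge0_ler_powR ?nnegrE// ltW.
have g_inv : (g%:R^-1) ^+ 2 <= 4 * m%:R `^ (- (2 / d%:R)) :> R.
  have mg' : m%:R `^ (1 / d%:R) <= 2 * g%:R :> R.
    apply: (@le_trans _ _ g.+1%:R); last by rewrite -natrM ler_nat mul2n -addnn -addn1 leq_add2l.
    have -> : g.+1%:R = (g.+1 ^ d)%:R `^ (1 / d%:R) :> R.
      by rewrite natrX -powR_mulrn// -powRrM mulrCA mulfV ?mulr1 ?powRr1// pnatr_eq0 -lt0n.
    by rewrite ge0_ler_powR ?nnegrE ?divr_ge0// ler_nat ltnW.
  have g0R : 0 < g%:R :> R by rewrite ltr0n.
  rewrite powRN exprVn ler_pdivlMr ?powR_gt0// mulrC ler_pdivrMr ?exprn_gt0//.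
  have -> : m%:R `^ (2 / d%:R) = (m%:R `^ (1 / d%:R)) ^+ 2 :> R.
    by rewrite -powR_mulrn ?powR_ge0// -powRrM; congr (_ `^ _); field; rewrite pnatr_eq0 -lt0n.
  have -> : 4 * g%:R ^+ 2 = (2 * g%:R) ^+ 2 :> R by ring.
  by rewrite ler_sqr ?nnegrE ?powR_ge0// mulr_ge0.
apply: (@inf_alg_error_le _ _ _ _ xs) => u v Uu Uv uv.
have near w : approx_unit_ball alpha l c w -> forall (z : unit_cube R d) i,
    (forall j, `|val z j 0 - val (xs i) j 0| <= g%:R^-1) ->
    `|w z - w (xs i)| <= (8 + 2 * (C3 + 1)) * m%:R `^ (- beta).
  move=> Uw z i zi.
  have [Phi [t [/andP[t0 t2] Pw Pd Pc Pu]]] := approx_unit_ball_network d0 Uw (ltn0Sn _ : (0 < n)%N).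
  have cn0 : 0 <= cn n := mulr_ge0 CC0 (powR_ge0 _ _).
  have Pc' : nn_norm Phi <= cn n by rewrite -lee_fin (le_trans Pc)// c_le.
  have PL : (nn_depth Phi <= L)%N.
    by have := le_trans Pd (lL n isT); rewrite lee_fin ler_nat.
  pose M := CC ^+ 2 * n%:R `^ (2 * ga).
  have ME : n%:R * cn n ^+ 2 = M.
    rewrite /M /cn exprMn mulrCA; congr (_ * _).
    rewrite -powR_mulrn ?powR_ge0// -powRrM -{1}(powRr1 (ler0n R n)) -powRD ?pnatr_eq0 ?implybT//.
    by congr (_ `^ _); rewrite /ga; field.
  have M1 : 1 <= M.
    by rewrite mulr_ege1 ?expr_ge1 ?powR_ge1 ?ler1n// mulr_ge0// ltW.
  have PM : (nn_weights Phi)%:R * cn n ^+ 2 <= M.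
    by rewrite -ME ler_wpM2r ?sqr_ge0// ler_nat.
  have Lip := realization_cube_sqlipschitz z (xs i) d0 cn0 Pc' PM M1 PL.
  have Lip2 : (realization Phi (val z) 0 0 - realization Phi (val (xs i)) 0 0) ^+ 2 <=
      ((C3 + 1) * m%:R `^ (- beta)) ^+ 2.
    apply: le_trans Lip _.
    have sq : sqnorm (val z - val (xs i)) <= d%:R * (g%:R^-1) ^+ 2.
      rewrite /sqnorm -[X in X%:R * _]card_ord mulr_natl -sumr_const.
      apply: ler_sum => j _; rewrite !mxE -(real_normK (num_real (_ - _))).
      by rewrite ler_sqr ?nnegrE// invr_ge0.
    (* The powers of M add up to 1 + 2 (2^(L-1) - 1) = K. *)
    have -> : M * (16 * M ^+ 2 * d%:R) ^+ (2 ^ L.-1 - 1) = M ^+ K * (16 * d%:R) ^+ E.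
      rewrite (_ : 16 * M ^+ 2 * d%:R = M ^+ 2 * (16 * d%:R)); last by ring.
      by rewrite exprMn mulrA -exprM -exprS /K (expn2_subn1 L0) mulnC.
    have nK : n%:R `^ (2 * ga * K%:R) <= 2 `^ (2 * ga * K%:R) * m%:R `^ (beta / alpha * (2 * ga * K%:R)).
      rewrite [leRHS](_ : _ = (2 * x) `^ (2 * ga * K%:R)); last first.
        by rewrite powRM ?powR_ge0// -powRrM.
      by rewrite ge0_ler_powR ?nnegrE ?(mulr_ge0 _ x0).
    have MK : M ^+ K <= CC ^+ (2 * K) * (2 `^ (2 * ga * K%:R) * m%:R `^ (beta / alpha * (2 * ga * K%:R))).
      rewrite /M exprMn -exprM -[(_ `^ _) ^+ K]powR_mulrn ?powR_ge0// -powRrM.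
      by rewrite ler_wpM2l// exprn_ge0.
    have gK : sqnorm (val z - val (xs i)) <= d%:R * (4 * m%:R `^ (- (2 / d%:R))).
      by apply: le_trans sq _; rewrite ler_wpM2l.
    have dE : 0 <= (16 * d%:R) ^+ E :> R by rewrite exprn_ge0// mulr_ge0.
    apply: (@le_trans _ _ (CC ^+ (2 * K) * (2 `^ (2 * ga * K%:R) *
        m%:R `^ (beta / alpha * (2 * ga * K%:R))) * (16 * d%:R) ^+ E *
        (d%:R * (4 * m%:R `^ (- (2 / d%:R)))))).
      apply: ler_pM => //; [|exact: sqnorm_ge0|by rewrite ler_wpM2r].
      exact: mulr_ge0 (exprn_ge0 _ (le_trans ler01 M1)) dE.
    rewrite [leLHS](_ : _ = C3 * (m%:R `^ (beta / alpha * (2 * ga * K%:R)) *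
        m%:R `^ (- (2 / d%:R)))); last by rewrite /C3; ring.
    rewrite -powRD ?pnatr_eq0 -?lt0n ?m0 ?implybT// exprMn.
    apply: (ler_pM C30 (powR_ge0 _ _) C3sq).
    rewrite -powR_mulrn ?powR_ge0// -powRrM ler_powR//.
    (* Multiplied by alpha and halved, the comparison of the exponents of m is [ga_le]. *)
    rewrite -(ler_pM2l al0) (_ : alpha * (_ + _) = 2 * (beta * K%:R * ga) - 2 * (alpha / d%:R)); last first.
      by field; rewrite !gt_eqF// ltr0n.
    by move: ga_le; clear; rewrite mulrDr; lra.
  have C0 : 0 <= (C3 + 1) * m%:R `^ (- beta) := mulr_ge0 C31 (powR_ge0 _ _).
  have Lip3 : `|realization Phi (val z) 0 0 - realization Phi (val (xs i)) 0 0| <=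
      (C3 + 1) * m%:R `^ (- beta).
    by rewrite -ler_sqr ?nnegrE// real_normK ?num_real.
  move: (Pu z) (Pu (xs i)) Lip3 C0.
  move: (realization Phi (val z) 0 0) (realization Phi (val (xs i)) 0 0) => p q up uq pq C0.
  have -> : w z - w (xs i) = (w z - t * p) + t * (p - q) - (w (xs i) - t * q) by ring.
  apply: le_trans (ler_normB _ _) _; apply: le_trans (lerD (ler_normD _ _) (lexx _)) _.
  have tpq : `|t * (p - q)| <= 2 * ((C3 + 1) * m%:R `^ (- beta)).
    by rewrite normrM (gtr0_norm t0) ler_pM ?(ltW t0) ?(ltW t2)//.
  apply: le_trans (lerD (lerD up tpq) uq) _.
  move: n_pow; clear; move: (n%:R `^ _) (m%:R `^ _) => P Q PQ; nra.
apply: unif_norm_le => z; have [i zi] := xsP z.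
rewrite [X in `|X|](_ : _ = (u z - u (xs i)) - (v z - v (xs i))); last first.
  by rewrite uv /=; transitivity (u z - v z) => //; ring.
apply: le_trans (ler_normB _ _) _.
apply: le_trans (lerD (near _ Uu z i zi) (near _ Uv z i zi)) _.
by clear; rewrite le_eqVlt; apply/orP; left; apply/eqP; ring.
Qed.

Lemma err_ge d (alpha theta kappa : R) (l c : nat -> \bar R) L :
  (0 < d)%N -> 0 < alpha -> 0 <= theta -> (0 < L)%N ->
  asymp c (fun n => (n%:R `^ theta * (ln (2 * n%:R)) `^ kappa)%:E) ->
  (forall n, (0 < n)%N -> (l n <= L%:R%:E)%E) ->
  ((1 / d%:R * (alpha / (alpha + (2 ^+ L - 1) * (theta + 1 / 2))))%:E <=
    err (@approx_unit_ball R d alpha l c) (@idfun (Ccube R d)))%E.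
Proof.
move=> d0 al0 th0 L0 ca lL; set target := 1 / _ * _.
have d0R : 0 < d%:R :> R by rewrite ltr0n.
have L1 : 0 <= 2 ^+ L - 1 :> R by rewrite subr_ge0 expr_ge1//; lra.
have D0 : 0 < alpha + (2 ^+ L - 1) * (theta + 1 / 2).
  by rewrite ltr_pwDl// mulr_ge0//; lra.
have target0 : 0 < target by rewrite /target mulr_gt0 ?divr_gt0.
apply/lee_addgt0Pr => e e0.
(* The order is a supremum, so exponents just below the target suffice; the maximum keeps them
   nonnegative. *)
pose beta := Num.max 0 (target - e).
apply: (@le_trans _ _ (beta%:E + e%:E)%E).
  by rewrite -EFinD lee_fin -lerBlDr le_max lexx orbT.
rewrite leeD2r//; apply: ereal_sup_ubound; exists beta => //; split.
  by rewrite le_max lexx.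
apply: (inf_alg_error_powR_le d0 al0 th0 L0 ca lL); first by rewrite le_max lexx.
have : beta < target by rewrite gt_max target0 ltrBlDr ltrDl.
have -> : target = alpha / d%:R / (alpha + (2 ^+ L - 1) * (theta + 1 / 2)).
  by rewrite /target mul1r mulrA; congr (_ * _); exact: mulrC.
by rewrite ltr_pdivlMr.
Qed.

End LowerBound.

(** * Bump networks *)

Section FiniteTypeLayers.
Variables (R : realType) (T : finType).

(** Layers are described by functions on a finite type of labelled neurons and moved to ordinals by
    [enum_val]. *)
Definition fcol (f : T -> R) : 'cV[R]_#|T| := \col_i f (enum_val i).

Definition fmx (A : T -> T -> R) : 'M[R]_#|T| :=
  \matrix_(i, j) A (enum_val i) (enum_val j).

Lemma sum_enum_val (F : T -> R) : \sum_(i < #|T|) F (enum_val i) = \sum_t F t.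
Proof. by rewrite [RHS]big_enum_val. Qed.

Lemma mul_fmx_fcol (A : T -> T -> R) (f : T -> R) :
  fmx A *m fcol f = fcol (fun t => \sum_t' A t t' * f t').
Proof.
apply/matrixP => i j; rewrite !mxE -sum_enum_val.
by apply: eq_bigr => k _; rewrite !mxE.
Qed.

Lemma map_requ_fcol (f : T -> R) : map_mx (@requ R) (fcol f) = fcol (fun t => requ (f t)).
Proof. by apply/matrixP => i j; rewrite !mxE. Qed.

End FiniteTypeLayers.

Lemma nnz_le (R : realType) m n (A : 'M[R]_(m, n)) : (nnz A <= m * n)%N.
Proof. by rewrite /nnz (leq_trans (max_card _))// card_prod !card_ord. Qed.

Lemma mx_norm_le (R : realType) m n (A : 'M[R]_(m, n)) (c : R) : 0 <= c ->
  (forall i j, `|A i j| <= c) -> `|A| <= c.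
Proof.
move=> c0 Ac; rewrite {1}/Num.Def.normr /= mx_normrE.
by apply/bigmax_leP; split => // -[i j] _; exact: Ac.
Qed.

Lemma nnz0 (R : realType) m n : nnz (0 : 'M[R]_(m, n)) = 0%N.
Proof.
by rewrite /nnz eq_card0// => p; apply/negbTE/negP; rewrite inE /= mxE eqxx.
Qed.

Section Bump.
Variables (R : realType) (d N : nat) (c a : R) (y : 'cV[R]_d).
Hypotheses (c1 : 1 <= c) (a01 : 0 <= a <= 1) (y01 : forall i, 0 <= y i 0 <= 1).
Hypotheses (d_gt0 : (0 < d)%N) (N_gt0 : (0 < N)%N).

(* A neuron (i, s, r) is the r-th of N copies carrying coordinate i with the
   sign [sg s] in {-1, 0, 1}. *)
Definition neuron : finType := ('I_d * 'I_3 * 'I_N)%type.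

Definition sg (t : neuron) : R := (t.1.2)%:R - 1.

Lemma sg_abs_le t : -1 <= sg t <= 1.
Proof.
rewrite /sg; case: t => [[i [s s3]] r] /=.
have : s%:R <= 2 :> R by rewrite ler_nat.
by have : 0 <= s%:R :> R by []; lra.
Qed.

Lemma sum_neuron (i : 'I_d) (F : R -> R) :
  \sum_(t : neuron) (t.1.1 == i)%:R * F (sg t) = N%:R * (F (- 1) + F 0 + F 1).
Proof.
rewrite -(pair_bigA _ (fun (p : 'I_d * 'I_3) (r : 'I_N) => (p.1 == i)%:R * F ((p.2)%:R - 1))) /=.
under eq_bigr do rewrite sumr_const card_ord.
rewrite -(pair_bigA _ (fun (j : 'I_d) (s : 'I_3) => ((j == i)%:R * F (s%:R - 1)) *+ N)) /=.
rewrite (bigD1 i)//= [X in _ + X]big1 ?addr0; last first.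
  by move=> j /negPf ->; rewrite big1// => s _; rewrite mul0r mul0rn.
rewrite !big_ord_recl big_ord0 eqxx /= /bump /= sub0r subrr addr0.
rewrite (_ : 2%:R - 1 = 1 :> R); last by lra.
by rewrite !mul1r mulr_natl !mulrnDl addrA.
Qed.

(** Applied to the squares K^2 (1 + s z)^2 within one coordinate: the neurons of sign 0 have weight
    c and give the constant N c K^2; the others have weight c / 4 up to sign and give sg t N c K^2
    z. *)
Definition mid_mx : 'M[R]_#|neuron| := fmx (fun t t' =>
  (t'.1.1 == t.1.1)%:R * (c * (1 - sg t' ^+ 2) + sg t * sg t' * (c / 4))).

(** [mid_mx] without its constant part, leaving a multiple of sg t z. *)
Definition lin_mx : 'M[R]_#|neuron| := fmx (fun t t' =>
  (t'.1.1 == t.1.1)%:R * (sg t * sg t' * (c / 4))).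

Lemma neuron_gt0 : (0 < #|neuron|)%N.
Proof. by rewrite !card_prod !card_ord !muln_gt0 d_gt0 N_gt0. Qed.

(** By [requ_opp] the two opposite signs give the full square of each coordinate; a single neuron
    then forms a minus their sum, and its ReQU is the bump. *)
Definition bump_tail : network R 1 #|neuron| :=
  HiddenLayer neuron_gt0 lin_mx 0
    (HiddenLayer (ltn0Sn 0) (const_mx (- 1)) (const_mx a)
      (OutputLayer 1%:M 0)).

Fixpoint bump_mid m : network R 1 #|neuron| :=
  if m is m'.+1 then HiddenLayer neuron_gt0 mid_mx 0 (bump_mid m') else bump_tail.

(** The amplitude c / 2 keeps the entries c / 2 (1 - s y) of [in_bias] within c. *)
Definition in_mx : 'M[R]_(#|neuron|, d) :=
  \matrix_(j, i) (((enum_val j).1.1 == i)%:R * (c / 2 * sg (enum_val j))).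

Definition in_bias : 'cV[R]_#|neuron| :=
  fcol (fun t : neuron => c / 2 * (1 - sg t * y t.1.1 0)).

Definition bump_net m : network R 1 d :=
  HiddenLayer neuron_gt0 in_mx in_bias (bump_mid m).

Fixpoint gain (m : nat) : R :=
  if m is m'.+1 then N%:R * c * gain m' ^+ 2 else c / 2.

Lemma bump_net_depth m : nn_depth (bump_net m) = m.+4.
Proof. by rewrite /=; congr _.+1; elim: m => //= m ->. Qed.

(** All entries are counted. With k = 3 d N neurons per layer, k >= d and k >= 3 let k^2 absorb the
    smaller blocks. *)
Lemma bump_net_weights m :
  (nn_weights (bump_net m) <= (5 + 2 * m) * (9 * d ^ 2) * N ^ 2)%N.
Proof.
have -> : ((5 + 2 * m) * (9 * d ^ 2) * N ^ 2 = (5 + 2 * m) * #|neuron| ^ 2)%N.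
  by rewrite !card_prod !card_ord; ring.
have dk : (d <= #|neuron|)%N.
  rewrite !card_prod !card_ord -mulnA leq_pmulr// muln_gt0 N_gt0//.
have k3 : (3 <= #|neuron|)%N.
  by rewrite !card_prod !card_ord mulnAC leq_pmull// muln_gt0 d_gt0.
have W p q (A : 'M[R]_(p, q)) : (nnz A <= p * q)%N := nnz_le A.
rewrite /=.
have := W _ _ in_mx; have := W _ _ in_bias.
have : (nn_weights (bump_mid m) <= (3 + 2 * m) * #|neuron| ^ 2)%N.
  elim: m => [|m IH] /=.
    have := W _ _ lin_mx; have := W _ _ (0 : 'cV[R]_#|neuron|).
    have := W _ _ (const_mx (- 1) : 'M[R]_(1, #|neuron|)).
    have := W _ _ (const_mx a : 'cV[R]_1); have := W _ _ (1%:M : 'M[R]_1).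
    have := W _ _ (0 : 'cV[R]_1).
    move: k3; clear; move: #|neuron| (nnz _) (nnz _) (nnz _) (nnz _) (nnz _) (nnz _).
    move=> k p1 p2 p3 p4 p5 p6; rewrite !muln1 !mul1n -mulnn => *.
    by have : (3 * k <= k * k)%N by [rewrite leq_mul2r; lia]; lia.
  have := W _ _ mid_mx; have := W _ _ (0 : 'cV[R]_#|neuron|).
  move: k3 IH; clear; move: #|neuron| (nnz _) (nnz _) (nn_weights _).
  move=> k p1 p2 p3; rewrite !muln1 -mulnn => *.
  by have : (3 * k <= k * k)%N by [rewrite leq_mul2r; lia]; lia.
move: k3 dk; clear; move: #|neuron| (nnz _) (nnz _) (nn_weights _).
move=> k p1 p2 p3; rewrite !muln1 -mulnn => k3 dk *.
have : (k * d <= k * k)%N by rewrite leq_mul2l dk orbT.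
by have : (3 * k <= k * k)%N by [rewrite leq_mul2r k3 orbT]; lia.
Qed.

Lemma mx0_norm_le p q : `|0 : 'M[R]_(p, q)| <= c.
Proof. by rewrite normr0 (le_trans ler01). Qed.

Lemma bump_net_norm m : nn_norm (bump_net m) <= c.
Proof.
have c0 : 0 <= c by have := c1; lra.
have delta_le (b : bool) (x : R) : `|x| <= c -> `|b%:R * x| <= c.
  by case: b; rewrite ?mul1r// mul0r normr0.
have ss (t t' : neuron) : `|sg t * sg t'| <= 1.
  rewrite normrM mulr_ile1//; by rewrite ler_norml sg_abs_le.
rewrite /= !ge_max; apply/andP; split; [apply/andP; split|].
- apply: mx_norm_le => // i j; rewrite mxE; apply: delta_le.
  have := sg_abs_le (enum_val i); move: (sg _) => s ?.
  by rewrite ler_norml; nra.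
- apply: mx_norm_le => // i j; rewrite mxE.
  have := sg_abs_le (enum_val i); have := y01 (enum_val i).1.1.
  move: (sg _) (y _ _) => s z ? ?.
  rewrite ler_norml; have : `|s * z| <= 1.
    by rewrite normrM mulr_ile1// ler_norml; lra.
  by rewrite ler_norml => ?; nra.
elim: m => [|m IH] /=; rewrite !ge_max mx0_norm_le ?IH ?andbT.
  repeat (apply/andP; split); try exact: mx0_norm_le; apply: mx_norm_le => // i j; rewrite !mxE.
  - apply: delta_le; have := ss (enum_val i) (enum_val j).
    move: (sg _ * sg _) => s; rewrite !ler_norml => ?; nra.
  - by rewrite normrN normr1.
  - by have /andP[a0 a1] := a01; rewrite ger0_norm// (le_trans a1).
  - by have := delta_le (i == j) 1; rewrite mulr1 normr1; exact.
apply: mx_norm_le => // i j; rewrite !mxE; apply: delta_le.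
have := ss (enum_val i) (enum_val j).
(* For each column only one of the two summands of [mid_mx] survives, so its entries do not exceed
   c. *)
have [->|->] : sg (enum_val j) = 0 \/ sg (enum_val j) ^+ 2 = 1.
- rewrite /sg; case: (enum_val j) => [[j1 [s s3]] j2] /=.
  case: s s3 => [|[|[|]]]//= _; [right|left|right]; ring.
- by move=> _; rewrite mulr0 mul0r expr0n subr0 mulr1 addr0 ger0_norm.
move: (sg _ * sg _) => w; rewrite subrr mulr0 add0r normrM => w1.
by rewrite (ger0_norm (_ : 0 <= c / 4)); nra.
Qed.

Section Eval.
Variable x : 'cV[R]_d.
Hypothesis x01 : forall i, 0 <= x i 0 <= 1.

Let z i : R := x i 0 - y i 0.

Definition ramp (K : R) : 'cV[R]_#|neuron| :=
  fcol (fun t : neuron => K * (1 + sg t * z t.1.1)).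

Lemma z_abs_le i : -1 <= z i <= 1.
Proof. by have := x01 i; have := y01 i; rewrite /z; lra. Qed.

Lemma gain_ge0 m : 0 <= gain m.
Proof.
elim: m => [|m IH] /=; first by rewrite divr_ge0// (le_trans ler01).
by rewrite !mulr_ge0 ?sqr_ge0// (le_trans ler01).
Qed.

Lemma requ_ge0E (r : R) : 0 <= r -> requ r = r ^+ 2.
Proof. by move=> r0; rewrite /requ max_r. Qed.

Lemma requ_le0E (r : R) : r <= 0 -> requ r = 0.
Proof. by move=> r0; rewrite /requ max_l// expr0n. Qed.

Lemma requ_opp (r : R) : requ (- r) + requ r = r ^+ 2.
Proof.
have [r0|r0] := leP 0 r.
  by rewrite [requ (- r)]requ_le0E ?oppr_le0// requ_ge0E// add0r.
by rewrite [requ r]requ_le0E 1?ltW// requ_ge0E ?addr0 ?sqrrN// oppr_ge0 ltW.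
Qed.

Lemma ramp_in : in_mx *m x + in_bias = ramp (gain 0).
Proof.
apply/matrixP => j k; rewrite ord1 !mxE /=.
rewrite (bigD1 (enum_val j).1.1)//= big1 ?addr0 => [|i /negPf ij]; last first.
  by rewrite mxE eq_sym ij !mul0r.
by rewrite mxE eqxx mul1r /z; move: (sg _) (x _ 0) (y _ 0) => s p q; field.
Qed.

(** On the cube |z| <= 1, so these neurons are nonnegative and ReQU acts as the plain square. *)
Lemma ramp_requ K (t : neuron) : 0 <= K ->
  requ (K * (1 + sg t * z t.1.1)) = K ^+ 2 * (1 + sg t * z t.1.1) ^+ 2.
Proof.
move=> K0; rewrite requ_ge0E ?exprMn// mulr_ge0//.
have : `|sg t * z t.1.1| <= 1.
  by rewrite normrM mulr_ile1// ler_norml ?sg_abs_le ?z_abs_le.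
by rewrite ler_norml; lra.
Qed.

(** The weight [w] is left free so that one computation serves both [mid_mx] and [lin_mx]. *)
Lemma sum_neuron_ramp K (t : neuron) (w : R -> R) : 0 <= K ->
  \sum_(t' : neuron) (t'.1.1 == t.1.1)%:R * w (sg t') * requ (K * (1 + sg t' * z t'.1.1)) =
  N%:R * K ^+ 2 * (w (- 1) * (1 - z t.1.1) ^+ 2 + w 0 + w 1 * (1 + z t.1.1) ^+ 2).
Proof.
move=> K0.
rewrite (eq_bigr (fun t' : neuron => (t'.1.1 == t.1.1)%:R *
   (fun s => w s * (K ^+ 2 * (1 + s * z t.1.1) ^+ 2)) (sg t'))); last first.
  move=> t' _; rewrite ramp_requ// -mulrA.
  by case: eqP => [->|_]//; rewrite !mul0r.
rewrite (sum_neuron t.1.1 (fun s => w s * (K ^+ 2 * (1 + s * z t.1.1) ^+ 2))).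
by move: (z _) (w _) (w _) (w _) => ? ? ? ?; ring.
Qed.

Lemma ramp_mid m : mid_mx *m map_mx (@requ R) (ramp (gain m)) + 0 = ramp (gain m.+1).
Proof.
rewrite addr0 /ramp map_requ_fcol mul_fmx_fcol; congr fcol; apply/funext => t.
rewrite (sum_neuron_ramp t (fun s => c * (1 - s ^+ 2) + sg t * s * (c / 4)))//=; last exact: gain_ge0.
by field.
Qed.

Lemma ramp_lin m : lin_mx *m map_mx (@requ R) (ramp (gain m)) + 0 =
  fcol (fun t : neuron => gain m.+1 * (sg t * z t.1.1)).
Proof.
rewrite addr0 /ramp map_requ_fcol mul_fmx_fcol; congr fcol; apply/funext => t.
rewrite (sum_neuron_ramp t (fun s => sg t * s * (c / 4)))//=; last exact: gain_ge0.
by field.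
Qed.

(** Induction with k free, since each middle layer turns gain k into gain k + 1; [lin_mx] accounts
    for the last successor. *)
Lemma bump_midE m k : realization (bump_mid m) (map_mx (@requ R) (ramp (gain k))) 0 0 =
  requ (a - N%:R * gain (m + k).+1 ^+ 2 * \sum_i z i ^+ 2).
Proof.
elim: m k => [|m IH] k; last first.
  by rewrite [LHS]/= ramp_mid IH addnS.
rewrite [LHS]/= ramp_lin map_requ_fcol mul1mx addr0 !mxE; congr requ.
rewrite addrC; congr (_ + _).
under eq_bigr do rewrite !mxE mulN1r.
rewrite sumrN; congr (- _); rewrite add0n.
rewrite (sum_enum_val (fun t : neuron => requ (gain k.+1 * (sg t * z t.1.1)))).
rewrite mulr_sumr.
transitivity (\sum_i \sum_(t : neuron) (t.1.1 == i)%:R * requ (gain k.+1 * (sg t * z i))).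
  rewrite exchange_big /=; apply: eq_bigr => t _.
  rewrite (bigD1 t.1.1)//= eqxx mul1r big1 ?addr0// => i /negPf.
  by rewrite eq_sym => ->; rewrite mul0r.
apply: eq_bigr => i _.
rewrite (sum_neuron i (fun s => requ (gain k.+1 * (s * z i)))).
rewrite mulN1r mul1r mul0r mulr0 [requ 0]requ_le0E// addr0 mulrN requ_opp.
by rewrite -mulrA exprMn.
Qed.

Lemma bump_netE m : realization (bump_net m) x 0 0 =
  requ (a - N%:R * gain m.+1 ^+ 2 * \sum_i z i ^+ 2).
Proof. by rewrite [LHS]/= ramp_in bump_midE addn0. Qed.

End Eval.

End Bump.

(** * Fooling functions *)

Section UpperBound.
Variables (R : realType) (d : nat).

(** The algorithm cannot tell u from 0, and by the triangle inequality its common answer is at least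
    H / 2 away from one of them. *)
Lemma inf_alg_error_ge (U : set (Ccube R d)) m (H : R) :
  U 0 ->
  (forall xs : 'I_m -> unit_cube R d, exists2 u, U u & (forall i, u (xs i) = 0) /\ H <= `|u|) ->
  ((H / 2)%:E <= ereal_inf [set alg_error U (@idfun (Ccube R d)) A | A in Alg (Y:=Ccube R d) m U])%E.
Proof.
move=> U0 fool; apply: le_ereal_inf_tmp => _ [A [xs [Q AQ]] <-].
have [u Uu [u0 Hu]] := fool xs.
have A0 : A u = A 0 by rewrite !AQ//; congr Q; apply/rowP => i; rewrite !mxE u0.
have le v : U v -> (`|A v - v|%:E <= alg_error U (@idfun (Ccube R d)) A)%E.
  by move=> Uv; apply: ereal_sup_ubound; exists v.
have [H0|H0] := leP (H / 2) `|A 0 - 0|.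
  by apply: le_trans (le _ U0); rewrite lee_fin.
apply: le_trans (le _ Uu); rewrite lee_fin A0.
rewrite subr0 in H0; have := ler_normB (A 0) (A 0 - u).
by rewrite opprB addrC subrK; lra.
Qed.

Lemma grid_point_cube g (f : {ffun 'I_d -> 'I_g}) :
  unit_cube R d (\col_i ((f i)%:R / g%:R)).
Proof.
move=> i; rewrite mxE; have fg := ltn_ord (f i).
have g0 : 0 < g%:R :> R by rewrite ltr0n (leq_ltn_trans _ fg).
by rewrite divr_ge0//= ler_pdivrMr// mul1r ler_nat ltnW.
Qed.

(** Pigeonhole: otherwise each node has a sample closer than w, and distinct nodes have distinct
    ones because nodes are 1 / g >= 2 w apart in some coordinate. *)
Lemma missed_grid_point g m (xs : 'I_m -> unit_cube R d) (w : R) :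
  (m < g ^ d)%N -> 2 * w <= g%:R^-1 ->
  exists f : {ffun 'I_d -> 'I_g}, forall i, exists k,
    w <= `|val (xs i) k 0 - (f k)%:R / g%:R|.
Proof.
move=> mg wg; apply/not_existsP => nf.
have near (f : {ffun 'I_d -> 'I_g}) : exists i, forall k,
    `|val (xs i) k 0 - (f k)%:R / g%:R| < w.
  apply/not_existsP => ni; apply: (nf f) => i.
  have /existsNP[k /negP] := ni i; rewrite -leNgt => kw.
  by exists k.
have [h hP] := choice near.
have : injective h.
  move=> f f' ff'; apply/ffunP => k; apply/val_inj/eqP.
  have := hP f k; have := hP f' k; rewrite -ff' distrC.
  move: (\val (xs (h f)) k 0) => q A B.
  have gt0 : (0 < g)%N by rewrite (leq_ltn_trans _ (ltn_ord (f k))).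
  have g0 : 0 < g%:R :> R by rewrite ltr0n.
  have : `|(f k)%:R / g%:R - (f' k)%:R / g%:R| < g%:R^-1 :> R.
    apply: lt_le_trans wg; move: A B; rewrite !ltr_norml; clear; lra.
  rewrite -mulrBl normrM [`|g%:R^-1|]gtr0_norm ?invr_gt0// -[ltRHS]mul1r ltr_pM2r ?invr_gt0//.
  rewrite ltr_norml => /andP[lo hi]; rewrite eqn_leq.
  rewrite -[(_ <= _)%N]ltnS -[(f' k <= _)%N]ltnS -!(ltr_nat R) -addn1 natrD -addn1 natrD.
  by apply/andP; split; move: lo hi; clear; lra.
move=> /leq_card; rewrite card_ffun !card_ord => /(leq_trans mg).
by rewrite ltnn.
Qed.


Lemma powR_exponent_le (k C x z : R) N1 : 0 < k ->
  (forall N : nat, (N1 <= N)%N -> (0 < N)%N -> k * N%:R `^ x <= C * N%:R `^ z) -> x <= z.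
Proof.
move=> k0 H; rewrite leNgt; apply/negP => zx.
have xz : 0 < x - z by rewrite subr_gt0.
pose B := Num.max 1 (C / k + 1).
have B1 : 1 <= B by rewrite le_max lexx.
(* Large enough that N^(x - z) >= B > C / k. *)
pose N := maxn N1 (Num.truncn (B `^ (x - z)^-1)).+1.
have N0 : (0 < N)%N by rewrite leq_max orbT.
have NR : 0 < N%:R :> R by rewrite ltr0n.
have := H N (leq_maxl _ _) N0.
have -> : N%:R `^ x = N%:R `^ (x - z) * N%:R `^ z :> R.
  by rewrite -powRD ?subrK// (gt_eqF NR) implybT.
rewrite mulrA ler_pM2r ?powR_gt0//.
have BN : B <= N%:R `^ (x - z).
  have {1}-> : B = (B `^ (x - z)^-1) `^ (x - z).
    by rewrite -powRrM mulVf ?gt_eqF// powRr1// (le_trans ler01).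
  rewrite ge0_ler_powR ?nnegrE ?powR_ge0 ?(ltW xz)// ltW//.
  by rewrite (lt_le_trans (truncnS_gt _))// ler_nat leq_maxr.
have : k * (C / k + 1) <= k * N%:R `^ (x - z).
  by rewrite ler_pM2l// (le_trans _ BN)// le_max lexx orbT.
rewrite mulrDr mulrCA mulfV ?gt_eqF// !mulr1 => h1 h2.
by have := le_trans h1 h2; rewrite gerDl leNgt k0.
Qed.

(** Half of theta is given up to absorb the logarithm; for theta = 0 the bound c >= 1 takes over. *)
Lemma asymp_powR_lower (c : nat -> \bar R) (theta kappa : R) : 0 <= theta ->
  (forall n : nat, (0 < n)%N -> nat_ge_or_infty R 1 (c n)) ->
  asymp c (fun n => (n%:R `^ theta * (ln (2 * n%:R)) `^ kappa)%:E) ->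
  exists2 k : R, 0 < k & forall n, (0 < n)%N ->
    exists c0 : R, [/\ c n = c0%:E, 1 <= c0 & k * n%:R `^ (theta / 2) <= c0].
Proof.
move=> th0 cv [C1 [C2 [C10 C20 cb]]].
have cR n : (0 < n)%N -> exists2 c0 : R, c n = c0%:E & 1 <= c0.
  move=> n0; have [cub _] := cb n n0; case: (cv n n0) => [E|[j j1 ->]].
    by move: cub; rewrite E -EFinM leye_eq.
  by exists j%:R => //; rewrite ler1n.
move: th0; rewrite le_eqVlt => /predU1P[<-|th0].
  exists 1 => // n n0; have [c0 -> c01] := cR n n0; exists c0; split => //.
  by rewrite mul0r powRr0 mul1r.
have [C C0 lnC] := powR_ln_le (- kappa) (divr_gt0 th0 (ltr0n R 2)).
exists (C2 * C)^-1 => [|n n0]; first by rewrite invr_gt0 mulr_gt0.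
have [c0 E c01] := cR n n0; exists c0; split => //.
have nR : 0 < n%:R :> R by rewrite ltr0n.
rewrite mulrC ler_pdivrMr ?mulr_gt0//.
have [_] := cb n n0; rewrite E -EFinM lee_fin.
have ln0 : 0 < ln (2 * n%:R : R).
  by rewrite ln_gt0// (@lt_le_trans _ _ 2) ?ltr1n// ler_peMr// ler1n.
have := lnC n n0; rewrite powRN => A B.
have h0 : 0 < n%:R `^ (theta / 2) :> R by rewrite powR_gt0.
have E2 : n%:R `^ theta = n%:R `^ (theta / 2) * n%:R `^ (theta / 2) :> R.
  by rewrite -powRD ?(gt_eqF nR) ?implybT//; congr (_ `^ _); field.
have := ler_pM (mulr_ge0 (powR_ge0 _ _) (powR_ge0 _ _)) _ B A.
rewrite invr_ge0 powR_ge0 mulfK ?gt_eqF ?powR_gt0// => /(_ isT).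
by rewrite E2 [X in _ <= X -> _]mulrA ler_pM2r// (_ : c0 * _ = C2 * c0 * C)//; ring.
Qed.

Lemma best_error_le (l c : nat -> \bar R) n (u : unit_cube R d -> R) (r : R) :
  (0 < n)%N -> nat_ge_or_infty R 5 (l n) -> nat_ge_or_infty R 1 (c n) ->
  0 <= r -> (forall x, `|u x| <= r) -> (best_error l c n u <= r%:E)%E.
Proof.
move=> n0 ln cn r0 ur.
apply: (@le_trans _ _ (Linfty_norm (fun x => u x - 0))); last first.
  by apply: Linfty_norm_le => // x; rewrite subr0.
apply: ereal_inf_lbound; exists (fun=> 0) => //.
exists (OutputLayer 0 0); split => /=.
- by rewrite !nnz0.
- by case: ln => [->|[j j5 ->]]; rewrite ?leey// lee_fin ler_nat; case: j j5.
- by rewrite !normr0 maxxx; case: cn => [->|[j j1 ->]]; rewrite ?leey// lee_fin.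
- by apply/funext => x; rewrite mul0mx addr0 mxE.
Qed.

(** With k weights allowed, k <= n, the zero network errs by at most n^-alpha <= k^-alpha; for k > n
    the network itself is admissible by monotonicity. *)
Lemma realization_approx_unit_ball (alpha : R) (l c : nat -> \bar R) (Phi : network R 1 d)
    (n : nat) (u : Ccube R d) :
  0 < alpha -> (0 < n)%N ->
  (forall n : nat, (0 < n)%N -> nat_ge_or_infty R 5 (l n)) -> nondecreasing_pos l ->
  (forall n : nat, (0 < n)%N -> nat_ge_or_infty R 1 (c n)) -> nondecreasing_pos c ->
  (nn_weights Phi <= n)%N -> ((nn_depth Phi)%:R%:E <= l n)%E ->
  ((nn_norm Phi)%:E <= c n)%E ->
  (forall x, u x = realization Phi (val x) 0 0) ->
  (forall x, `|u x| <= n%:R `^ (- alpha)) ->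
  approx_unit_ball alpha l c u.
Proof.
move=> al0 n0 lv lm cv cm Pw Pd Pc uP un.
have nR : 1 <= n%:R :> R by rewrite ler1n.
have p1 : n%:R `^ (- alpha) <= 1 :> R.
  by rewrite powRN invf_le1 ?powR_gt0 ?(lt_le_trans ltr01)// powR_ge1// ltW.
apply: ereal_inf_lbound; exists 1 => //; split => //.
under [fun x => _]eq_fun do rewrite divr1.
rewrite /approx_gauge ge_max; apply/andP; split.
  by apply: Linfty_norm_le => // x; apply: le_trans p1.
apply: ge_ereal_sup => _ [k /= k0 <-].
have kR : 0 < k%:R :> R by rewrite ltr0n.
rewrite -lee_pdivlMl ?powR_gt0// mule1 -powRN.
have [kn|nk] := leqP k n.
  apply: (best_error_le k0 (lv _ k0) (cv _ k0) (powR_ge0 _ _)) => x.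
  apply: le_trans (un x) _; rewrite !powRN lef_pV2 ?posrE ?powR_gt0 ?ltr0n//.
  by rewrite ge0_ler_powR ?nnegrE ?(ltW al0)// ler_nat.
apply: (@le_trans _ _ (Linfty_norm (fun x => u x - realization Phi (val x) 0 0))).
  apply: ereal_inf_lbound; exists (fun x => realization Phi x 0 0) => //.
  exists Phi; split => //.
  - exact: leq_trans Pw (ltnW nk).
  - exact: le_trans Pd (lm _ _ n0 (ltnW nk)).
  - exact: le_trans Pc (cm _ _ n0 (ltnW nk)).
apply: Linfty_norm_le => [|x]; first exact: powR_ge0.
by rewrite uP subrr normr0 powR_ge0.
Qed.

End UpperBound.

(** * Growth of the gain and choice of parameters for the upper bound *)

Section ErrUpperBound.
Variable R : realType.

(** Multiplication by N c turns the recursion K' = N c K^2 into pure squaring. *)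
Lemma gain_closed N (c : R) k :
  N%:R * c * gain N c k = (N%:R * c ^+ 2 / 2) ^+ (2 ^ k).
Proof.
elim: k => [|k IH] /=; first by rewrite expn0 expr1; ring.
rewrite expnS mulnC exprM -IH; ring.
Qed.

Lemma gain_lower N (c k t : R) m : (0 < N)%N -> 1 <= c -> 0 < k -> k * N%:R `^ t <= c ->
  k ^+ (2 ^ m.+1 - 1) / 2 ^+ (2 ^ m) * N%:R `^ ((2 ^ m - 1)%:R + t * (2 ^ m.+1 - 1)%:R)
    <= gain N c m.
Proof.
move=> N0 c1 k0 kc.
have NR : 0 < N%:R :> R by rewrite ltr0n.
have c0 : 0 < c by rewrite (lt_le_trans ltr01).
have p0 : (0 < 2 ^ m)%N by rewrite expn_gt0.
have -> : gain N c m = N%:R ^+ (2 ^ m - 1) * c ^+ (2 ^ m.+1 - 1) / 2 ^+ (2 ^ m).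
  apply: (@mulfI _ (N%:R * c)); first by rewrite gt_eqF// mulr_gt0.
  have Np : N%:R ^+ (2 ^ m) = N%:R * N%:R ^+ (2 ^ m - 1) :> R.
    by rewrite -exprS subn1 prednK.
  have cp : (c ^+ 2) ^+ (2 ^ m) = c * c ^+ (2 ^ m.+1 - 1).
    by rewrite -exprS -exprM subn1 prednK ?expn_gt0// expnS.
  rewrite gain_closed exprMn exprVn [(N%:R * _) ^+ _]exprMn Np cp.
  by move: (_ ^+ _) (_ ^+ _) (_ ^+ _)^-1 => *; ring.
rewrite powRD ?(gt_eqF NR) ?implybT// powR_mulrn// powRrM powR_mulrn ?powR_ge0//.
rewrite [leLHS](_ : _ = N%:R ^+ (2 ^ m - 1) * (k * N%:R `^ t) ^+ (2 ^ m.+1 - 1) / 2 ^+ (2 ^ m)); last first.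
  by rewrite exprMn; move: (_ ^+ _) (_ ^+ _) (_ ^+ _) (_ ^+ _) => *; ring.
rewrite ler_pM2r ?invr_gt0 ?exprn_gt0// ler_pM2l ?exprn_gt0//.
by rewrite lerXn2r ?nnegrE ?mulr_ge0 ?powR_ge0// ltW.
Qed.

(** Already gain 1 = N c^3 / 4 is at least 4; this later gives the grid at least two nodes per
    axis. *)
Lemma gain_ge4 N (c : R) m : (15 < N)%N -> 1 <= c -> 4 <= gain N c m.+1.
Proof.
move=> N16 c1; have NR : 16 <= N%:R :> R by rewrite (ler_nat R 16).
elim: m => [|m IH] /=.
  have : 1 <= c * c ^+ 2 by rewrite mulr_ege1 ?expr_ge1// (le_trans ler01).
  rewrite exprMn; nra.
have : 1 <= N%:R * c by rewrite mulr_ege1//; lra.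
by move: IH => /=; set q := N%:R * c * _; move: q (N%:R * c) => q w *; nra.
Qed.

Lemma sampling_obstruction d (alpha c0 : R) (l c : nat -> \bar R) n N m M g :
  (0 < d)%N -> 0 < alpha -> (0 < n)%N -> (15 < N)%N ->
  (forall n : nat, (0 < n)%N -> nat_ge_or_infty R 5 (l n)) -> nondecreasing_pos l ->
  (forall n : nat, (0 < n)%N -> nat_ge_or_infty R 1 (c n)) -> nondecreasing_pos c ->
  ((5 + 2 * m) * (9 * d ^ 2) * N ^ 2 <= n)%N -> ((m.+4)%:R%:E <= l n)%E ->
  c n = c0%:E -> 1 <= c0 ->
  (M < g ^ d)%N -> 2 * (n%:R `^ (- (alpha / 4)) / gain N c0 m.+1) <= g%:R^-1 ->
  ((n%:R `^ (- alpha) / 2)%:E <= ereal_inf [set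
      alg_error (approx_unit_ball alpha l c) (@idfun (Ccube R d)) A |
        A in Alg (Y:=Ccube R d) M (approx_unit_ball alpha l c)])%E.
Proof.
move=> d0 al0 n0 N16 lv lm cv cm nD ml cn c01 Mg wg.
have N0 : (0 < N)%N by apply: leq_trans N16.
have nR : 1 <= n%:R :> R by rewrite ler1n.
have n0R : 0 < n%:R :> R by rewrite ltr0n.
set K := gain N c0 m.+1 in wg.
have K4 : 4 <= K by exact: gain_ge4.
have K0 : 0 < K by rewrite (lt_le_trans _ K4).
set b := n%:R `^ (- (alpha / 4)) in wg.
have b0 : 0 < b by rewrite powR_gt0.
have b1 : b <= 1.
  by rewrite /b powRN invf_le1 ?powR_gt0// powR_ge1// divr_ge0// ltW.
have b4 : n%:R `^ (- alpha) = (b ^+ 2) ^+ 2.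
  rewrite -exprM -powR_mulrn ?(ltW b0)// /b -powRrM; congr (_ `^ _).
  by field.
have a01 : 0 <= b ^+ 2 <= 1 by rewrite sqr_ge0 expr_le1// ltW.
have a2 : 0 <= (b ^+ 2) ^+ 2 <= 1 by rewrite sqr_ge0 expr_le1//; case/andP: a01.
apply: inf_alg_error_ge => //.
  apply: (@realization_approx_unit_ball _ _ _ _ _ (OutputLayer 0 0) n) => //.
  - by rewrite /= !nnz0.
  - by apply: le_trans ml; rewrite lee_fin ler_nat.
  - by rewrite cn lee_fin /= !normr0 maxxx (le_trans ler01).
  - by move=> x; rewrite /= mul0mx addr0 mxE.
  - by move=> x; rewrite normr0 powR_ge0.
move=> xs; have [f fP] := missed_grid_point xs Mg wg.
have yc := grid_point_cube R f.
set y := (\col_i _) in yc.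
pose Phi := bump_net c0 (b ^+ 2) y d0 N0 m.
have cPhi : (fun x : unit_cube R d => realization Phi (val x) 0 0) \in @continuous_cube R d.
  by rewrite inE; exact: realization_cube_continuous.
pose u := MkCcube cPhi.
have uE x : u x = requ (b ^+ 2 - N%:R * K ^+ 2 * \sum_i (val x i 0 - y i 0) ^+ 2).
  by rewrite /u /= bump_netE// => i; exact: cube_coord_bound.
have S0 (x : unit_cube R d) : 0 <= N%:R * K ^+ 2 * \sum_i (val x i 0 - y i 0) ^+ 2 :> R.
  by apply: mulr_ge0; [rewrite mulr_ge0 ?sqr_ge0|apply: sumr_ge0 => i _; exact: sqr_ge0].
exists u; last split.
- apply: (@realization_approx_unit_ball _ _ _ _ _ Phi n) => //.
  + exact: leq_trans (bump_net_weights _ _ _ _ _ _) nD.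
  + by rewrite bump_net_depth.
  + by rewrite cn lee_fin bump_net_norm.
  + move=> x; rewrite b4 uE ger0_norm ?requ_ge0//.
    have [q|q] := leP 0 (b ^+ 2 - N%:R * K ^+ 2 * \sum_i (val x i 0 - y i 0) ^+ 2).
      rewrite requ_ge0E// lerXn2r ?nnegrE//; first by case/andP: a01.
      by rewrite gerBl.
    by rewrite requ_le0E ?sqr_ge0// ltW.
- move=> i; rewrite uE requ_le0E// subr_le0.
  have [k kP] := fP i.
  have yk : y k 0 = (f k)%:R / g%:R by rewrite mxE.
  (* One coordinate at distance b / K suffices: it alone contributes at least b^2, and the factor N
     only helps. *)
  apply: (@le_trans _ _ (K ^+ 2 * (val (xs i) k 0 - y k 0) ^+ 2)).
    have bK : b <= K * `|val (xs i) k 0 - y k 0| by rewrite yk mulrC -ler_pdivrMr.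
    rewrite -[X in _ * X]real_normK ?num_real// -exprMn.
    by rewrite lerXn2r ?nnegrE ?(ltW b0) ?(le_trans (ltW b0) bK).
  have zk : (val (xs i) k 0 - y k 0) ^+ 2 <= \sum_j (val (xs i) j 0 - y j 0) ^+ 2.
    by rewrite (bigD1 k)//= lerDl sumr_ge0// => j _; exact: sqr_ge0.
  rewrite -mulrA (le_trans (ler_wpM2l (sqr_ge0 K) zk))// ler_peMl ?ler1n//.
  by rewrite mulr_ge0 ?sqr_ge0// (le_trans _ zk)// sqr_ge0.
have y01 : unit_cube R d y := yc.
pose Y : unit_cube R d := exist _ y (mem_set y01).
apply: le_trans (unif_norm_ge u Y); rewrite uE b4 big1 => [|i _]; last first.
  by rewrite subrr expr0n.
by rewrite mulr0 subr0 requ_ge0E ?ler_norm//; case/andP: a01.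
Qed.

Lemma err_le d (alpha theta kappa : R) (l c : nat -> \bar R) L n0 :
  (0 < d)%N -> 0 < alpha -> 0 <= theta -> (4 < L)%N ->
  (forall n : nat, (0 < n)%N -> nat_ge_or_infty R 1 (c n)) -> nondecreasing_pos c ->
  asymp c (fun n => (n%:R `^ theta * (ln (2 * n%:R)) `^ kappa)%:E) ->
  (forall n : nat, (0 < n)%N -> nat_ge_or_infty R 5 (l n)) -> nondecreasing_pos l ->
  (forall n : nat, (0 < n)%N -> (n0 <= n)%N -> l n = L%:R%:E) ->
  (err (@approx_unit_ball R d alpha l c) (@idfun (Ccube R d)) <=
    (64 / d%:R * (alpha / (8 * alpha + (2 ^+ L - 1) * (theta + 1 / 2))))%:E)%E.
Proof.
move=> d0 al0 th0 L5 cv cm ca lv lm lL.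
have dR : 0 < d%:R :> R by rewrite ltr0n.
have [m Lm] : exists m, L = m.+4 by exists (L - 4)%N; rewrite -addn4 subnK// ltnW.
have m0 : (0 < m)%N by move: L5; rewrite Lm.
apply: ge_ereal_sup => _ [be [be0 [C C0 H]] <-]; rewrite lee_fin.
pose D := ((5 + 2 * m) * (9 * d ^ 2))%N.
have D0 : (0 < D)%N by rewrite /D !muln_gt0 addn_gt0 d0.
have [k k0 kc] := asymp_powR_lower th0 cv ca.
pose p := (2 ^ m.+1)%N.
pose p2 := (2 ^ m.+2)%N.
pose k2 := k ^+ (p2 - 1) / 2 ^+ p.
have k20 : 0 < k2 by rewrite divr_gt0 ?exprn_gt0.
(* The exponent of N in K / b: the first two terms come from [gain_lower] at m + 1, and alpha / 2
   from b^-1 = n^(alpha / 4) with n >= N^2. *)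
pose E := (p - 1)%:R + theta * (p2 - 1)%:R + alpha / 2.
have key : E * d%:R * be <= 2 * alpha.
  (* N >= 16 is for [gain_ge4]; N >= n0 makes the full depth available. The exponent 2 alpha stems
     from n = D N^2. *)
  apply: (@powR_exponent_le _ (((k2 / 4) ^+ d / 2) `^ be) (2 * C * D%:R `^ alpha) _ _ (maxn 16 n0)).
    by rewrite powR_gt0// divr_gt0 ?exprn_gt0// divr_gt0.
  move=> N; rewrite geq_max => /andP[N16 n0N] N0.
  have NR : 0 < N%:R :> R by rewrite ltr0n.
  pose n := (D * N ^ 2)%N.
  have nN : (N ^ 2 <= n)%N by rewrite leq_pmull.
  have nN1 : (N <= n)%N by rewrite (leq_trans _ nN)// -{1}(expn1 N) leq_pexp2l.
  have n_gt0 : (0 < n)%N by rewrite (leq_trans N0).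
  have nR : 0 < n%:R :> R by rewrite ltr0n.
  have [c0 [cn c01 kc0]] := kc n n_gt0.
  have kN : k * N%:R `^ theta <= c0.
    apply: le_trans kc0; rewrite ler_pM2l//.
    have -> : N%:R `^ theta = (N ^ 2)%:R `^ (theta / 2) :> R.
      by rewrite natrX -powR_mulrn// -powRrM; congr (_ `^ _); field.
    by rewrite ge0_ler_powR ?nnegrE ?divr_ge0// ler_nat.
  have K_ge := gain_lower m.+1 N0 c01 k0 kN.
  have K4 := gain_ge4 m N16 c01.
  have ln_ge : ((m.+4)%:R%:E <= l n)%E by rewrite lL// ?Lm// (leq_trans n0N).
  have obs M g := @sampling_obstruction d alpha c0 l c n N m M g d0 al0 n_gt0 N16
    lv lm cv cm (leqnn _) ln_ge cn c01.
  move: K_ge K4 obs; rewrite -/p -/p2 -/k2; move: (gain N c0 m.+1) => K K_ge K4 obs.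
  pose b := n%:R `^ (- (alpha / 4)) : R.
  have b0 : 0 < b by rewrite powR_gt0.
  have b1 : b <= 1.
    by rewrite /b powRN invf_le1 ?powR_gt0// powR_ge1 ?ler1n// divr_ge0// ltW.
  have bN : N%:R `^ (alpha / 2) <= b^-1.
    rewrite /b powRN invrK.
    have -> : N%:R `^ (alpha / 2) = (N ^ 2)%:R `^ (alpha / 4) :> R.
      by rewrite natrX -powR_mulrn// -powRrM; congr (_ `^ _); field.
    by rewrite ge0_ler_powR ?nnegrE ?divr_ge0 ?(ltW al0)// ler_nat.
  pose X := K / b.
  have X4 : 4 <= X by rewrite /X ler_pdivlMr//; nra.
  have XN : k2 * N%:R `^ E <= X.
    rewrite /E powRD ?(gt_eqF NR) ?implybT// mulrA.
    exact: ler_pM (mulr_ge0 (ltW k20) (powR_ge0 _ _)) (powR_ge0 _ _) K_ge bN.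
  (* The finest grid whose nodes are still 2 b / K = 2 / X apart; one sample fewer than its nodes is
     then taken. *)
  pose g := Num.truncn (X / 2).
  have /andP[g1 g2] : g%:R <= X / 2 < g.+1%:R by rewrite truncn_itv//; lra.
  rewrite -[g.+1]addn1 natrD in g2.
  have gX : X / 4 <= g%:R by lra.
  have g_gt1 : (1 < g)%N by rewrite /g truncn_ge_nat; lra.
  have gR : 0 < g%:R :> R by rewrite ltr0n ltnW.
  have gd1 : (1 < g ^ d)%N.
    by rewrite (leq_trans g_gt1)// -{1}(expn1 g) leq_pexp2l// ltnW.
  pose M := (g ^ d).-1.
  have M0 : (0 < M)%N by rewrite /M -ltnS prednK// ltnW.
  have Mlt : (M < g ^ d)%N by rewrite /M prednK// ltnW.
  have wg : 2 * (b / K) <= g%:R^-1.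
    have KX : b / K = X^-1 by rewrite /X invf_div.
    have X0 : 0 < X by lra.
    by rewrite KX ler_pdivrMr// mulrC ler_pdivlMr//; lra.
  have := le_trans (obs M g Mlt wg) (H M M0); rewrite lee_fin => ineq.
  have MX : (k2 / 4) ^+ d / 2 * N%:R `^ (E * d%:R) <= M%:R.
    apply: (@le_trans _ _ ((X / 4) ^+ d / 2)).
      rewrite mulrAC ler_pM2r ?invr_gt0// powRrM powR_mulrn ?powR_ge0// -exprMn.
      have A : 0 <= k2 / 4 * N%:R `^ E by apply: mulr_ge0 (powR_ge0 _ _); apply/ltW/divr_gt0.
      have B : k2 / 4 * N%:R `^ E <= X / 4 by rewrite mulrAC ler_pM2r// invr_gt0.
      by rewrite lerXn2r ?nnegrE ?A ?(le_trans A B).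
    rewrite ler_pdivrMr//; apply: (@le_trans _ _ (g ^ d)%:R).
      rewrite natrX lerXn2r ?nnegrE//; first by rewrite divr_ge0// (le_trans _ X4).
    rewrite -natrM ler_nat /M; move: gd1; move: (g ^ d)%N; clear.
    by case=> [|[|q]]// _; lia.
  have MR : 0 < M%:R :> R by rewrite ltr0n.
  have MC : M%:R `^ be <= 2 * C * n%:R `^ alpha.
    move: ineq; rewrite !powRN.
    have := powR_gt0 be MR; have := powR_gt0 alpha nR.
    move: (_ `^ alpha) (_ `^ be) => A B A0 B0.
    rewrite ler_pdivlMr// => AB.
    have -> : B = 2 * A * (A^-1 / 2 * B) by field; rewrite gt_eqF.
    by rewrite [leRHS]mulrAC ler_wpM2l// mulr_ge0// ltW.
  have -> : 2 * C * D%:R `^ alpha * N%:R `^ (2 * alpha) = 2 * C * n%:R `^ alpha.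
    rewrite -mulrA; congr (_ * _); rewrite /n natrM powRM ?ler0n//; congr (_ * _).
    by rewrite natrX -powR_mulrn// -powRrM.
  apply: le_trans MC.
  rewrite [E * d%:R * be]mulrC [X in _ * N%:R `^ X]mulrC powRrM -powRM ?powR_ge0//.
    rewrite ge0_ler_powR ?nnegrE ?mulr_ge0 ?divr_ge0 ?exprn_ge0 ?powR_ge0//.
    by rewrite divr_ge0// ltW.
  by rewrite divr_ge0// exprn_ge0// divr_ge0// ltW.
have P0 : 0 < 8 * alpha + (2 ^+ L - 1) * (theta + 1 / 2).
  rewrite ltr_pwDl ?mulr_gt0// mulr_ge0 ?subr_ge0 ?exprn_ege1 ?ler1n//; first by lra.
have p4 : 4 <= p%:R :> R.
  by rewrite (ler_nat R 4) /p -[4%N]/(2 ^ 2)%N leq_pexp2l.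
have LE : 2 ^+ L = 8 * p%:R :> R.
  by rewrite Lm /p natrX exprS exprS exprS; ring.
have pE : (p - 1)%:R = p%:R - 1 :> R by rewrite natrB// expn_gt0.
have p2E : (p2 - 1)%:R = 2 * p%:R - 1 :> R.
  by rewrite natrB ?expn_gt0// /p2 expnS natrM.
rewrite -(ler_pM2l dR) [leRHS](_ : _ = 64 * alpha / (8 * alpha + (2 ^+ L - 1) * (theta + 1 / 2))); last first.
  by rewrite mulrA [d%:R * _]mulrC divfK ?gt_eqF// mulrA.
rewrite ler_pdivlMr//.
(* With 2^L = 8 p and p >= 4 the factor 32 covers all losses, including the halved theta; with [key]
   it yields 64. *)
have E_ge : (8 * alpha + (2 ^+ L - 1) * (theta + 1 / 2)) <= 32 * E.
  rewrite /E pE p2E LE; move: p4 th0 al0; clear; move: p%:R => q *; nra.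
have dbe : 0 <= d%:R * be by rewrite mulr_ge0// ltW.
apply: (le_trans (ler_wpM2l dbe E_ge)).
have -> : d%:R * be * (32 * E) = 32 * (E * d%:R * be) by ring.
have -> : 64 * alpha = 32 * (2 * alpha) by ring.
by rewrite ler_pM2l.
Qed.

End ErrUpperBound.

Theorem theorem1p1 (R : realType) (d : nat) (alpha theta kappa : R)
    (l c : nat -> \bar R)
    (d_gt0 : (0 < d)%N) (alpha_gt0 : 0 < alpha) (theta_ge0 : 0 <= theta)
    (c_val : forall n : nat, (0 < n)%N -> nat_ge_or_infty R 1 (c n))
    (c_mono : nondecreasing_pos c)
    (c_asymp : asymp c
       (fun n => (n%:R `^ theta * (ln (2 * n%:R)) `^ kappa)%:E))
    (l_val : forall n : nat, (0 < n)%N -> nat_ge_or_infty R 5 (l n))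
    (l_mono : nondecreasing_pos l)
    (l_sup : (sup_pos l < +oo)%E) :
  let lstar : R := fine (sup_pos l) in
  let e : \bar R := err (@approx_unit_ball R d alpha l c) (@idfun (Ccube R d)) in
  ((1 / d%:R * (alpha / (alpha + (2 `^ lstar - 1) * (theta + 1 / 2))))%:E <= e)%E
  /\
  (e <= (64 / d%:R * (alpha / (8 * alpha + (2 `^ lstar - 1) * (theta + 1 / 2))))%:E)%E.
Proof.
have [L [n0 [L5 supL lL lLn]]] := sup_pos_nat l_val l_mono l_sup.
rewrite /= supL /= powR_mulrn//; split.
  by apply: err_ge c_asymp lL => //; apply: leq_trans L5.
exact: err_le L5 c_val c_mono c_asymp l_val l_mono lLn.
Qed.
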